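(* For all $u\in C^1[0,\varrho_\Omega)$ the following equalities hold on $[0,\varrho_\Omega)$: $$\mathbf{D}_f\mathbf{T}_{\frac1f}u=\mathbf{T}_f\mathbf{D}_1u,\qquad \mathbf{D}_{\frac1f}\mathbf{T}_fu=\mathbf{T}_{\frac1f}\mathbf{D}_1u.$$
   Context: Setting. $\varrho_\Omega>0$ is the supremum of $|z|$ over a bounded domain $\Omega\subset\mathbb{C}$ star-shaped with respect to $0$ (only the number $\varrho_\Omega$ matters here). The function $q_f\in C^1[0,\varrho_\Omega]$ is complex-valued, and $f\in C^2[0,\varrho_\Omega]$ is complex-valued, nowhere zero on $[0,\varrho_\Omega]$, satisfies $f''(r)+\frac1rf'(r)-q_f(r)f(r)=0$ on $(0,\varrho_\Omega)$, with $z\mapsto f(|z|)$ in $C^2(\overline\Omega)$, and is normalized by $f(0)=1$ and $\lim_{r\to0^+}rf'(r)=0$. Put $q_{\frac1f}=2\left(\frac{f'}{f}\right)^2-q_f$, the potential associated in the same way to $\frac1f$. For $g\in\{f,\frac1f\}$ let $G^g\in C^2([0,\varrho_\Omega]\times[0,1])$ be the kernel (known to exist) satisfying $$r\left(G^g_{rr}(r,t)-q_g(r)G^g(r,t)\right)-G^g_r(r,t)+2(1-t)G^g_{rt}(r,t)=0,$$ $$G^g(r,0)=\int_0^r\tau q_g(\tau)\,d\tau,\qquad G^g(0,t)=0.$$ On functions $u$ of the radial variable, $\mathbf{T}_gu(r)=u(r)+\int_0^1\sigma\,G^g(r,1-\sigma^2)\,u(\sigma^2r)\,d\sigma$. The first-order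 operators are $\mathbf{D}_gu=\frac{r}{g}\frac{d}{dr}(gu)$ for $g\in\{f,\frac1f,1\}$; thus $\mathbf{D}_{\frac1f}u=rf\frac{d}{dr}\left(\frac{u}{f}\right)$ and $\mathbf{D}_1u=r\frac{du}{dr}$. Functions $u$ are complex-valued. *)

(* Defs.v *)
From Stdlib Require Import Reals Lra.
From Coquelicot Require Import Coquelicot.
Open Scope R_scope.

(** Stdlib reals with Coquelicot.  Functions of the radial variable are
    total maps [R -> C]; only their values on the relevant interval matter. *)

Definition Icc (a b : R) : R -> Prop := fun x => a <= x <= b.
Definition Ico (a b : R) : R -> Prop := fun x => a <= x < b.

(** Coquelicot's [is_derive] with [locally x] relativized to [D]: at an endpoint
    of an interval [D] this is the one-sided derivative. *)
Definition is_derive_on (D : R -> Prop) (f : R -> C) (x : R) (l : C) : Prop :=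
  filterdiff (U := R_NormedModule) (V := C_R_NormedModule)
    f (within D (locally x)) (fun h : R => scal h (l : C_R_NormedModule)).

Definition ex_derive_on (D : R -> Prop) (f : R -> C) (x : R) : Prop :=
  exists l : C, is_derive_on D f x l.

(** Like [RInt], a total operator, meaningful when [ex_derive_on D f x] holds
    and [x] is an accumulation point of [D] that belongs to [D]. *)
Definition derive_on (D : R -> Prop) (f : R -> C) (x : R) : C :=
  iota (T := C_R_CompleteNormedModule) (is_derive_on D f x).

Fixpoint Ck_on (k : nat) (D : R -> Prop) (f : R -> C) : Prop :=
  match k with
  | O => continuous_on D f
  | S k' => (forall x, D x -> ex_derive_on D f x) /\ Ck_on k' D (derive_on D f)
  end.

Definition RIntC (h : R -> C) (a b : R) : C :=
  RInt (V := C_R_CompleteNormedModule) h a b.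

(** Partial derivatives on [[0,rho] x [0,1]], one-sided on the sides. *)

Definition dr (rho : R) (G : R -> R -> C) (r t : R) : C :=
  derive_on (Icc 0 rho) (fun s => G s t) r.

Definition dt (G : R -> R -> C) (r t : R) : C :=
  derive_on (Icc 0 1) (fun s => G r s) t.

Definition C0_rect (rho : R) (G : R -> R -> C) : Prop :=
  continuous_on (fun p : R * R => Icc 0 rho (fst p) /\ Icc 0 1 (snd p))
    (fun p => G (fst p) (snd p)).

Definition C1_rect (rho : R) (G : R -> R -> C) : Prop :=
  C0_rect rho G /\
  (forall r t, Icc 0 rho r -> Icc 0 1 t ->
     ex_derive_on (Icc 0 rho) (fun s => G s t) r /\
     ex_derive_on (Icc 0 1) (fun s => G r s) t) /\
  C0_rect rho (dr rho G) /\ C0_rect rho (dt G).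

Definition C2_rect (rho : R) (G : R -> R -> C) : Prop :=
  C1_rect rho G /\ C1_rect rho (dr rho G) /\ C1_rect rho (dt G).

Definition closure_of (Om : C -> Prop) (z : C) : Prop :=
  forall P : C -> Prop, locally z P -> exists w, Om w /\ P w.

(** A domain star-shaped with respect to [0] whose supremum of [|z|] is the real
    number [rho]; in particular it is bounded, and it is connected because it is
    star-shaped. *)
Definition star_domain (Om : C -> Prop) (rho : R) : Prop :=
  open Om /\ Om 0%C /\
  (forall z s, Om z -> 0 <= s <= 1 -> Om (RtoC s * z)%C) /\
  is_lub (fun x => exists z, Om z /\ x = Cmod z) rho.

(** [phi] has partial derivatives [phix], [phiy] on [Om] (with [z = (x, y)]). *)
Definition partials_on (Om : C -> Prop) (phi phix phiy : C -> C) : Prop :=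
  forall z : C, Om z ->
    is_derive (V := C_R_NormedModule) (fun s : R => phi (s, snd z)) (fst z) (phix z) /\
    is_derive (V := C_R_NormedModule) (fun s : R => phi (fst z, s)) (snd z) (phiy z).

(** [phi] is in [C^2] of the closure of [Om]: all partial derivatives of order at
    most two exist on [Om] and extend continuously to the closure. *)
Definition C2_closure (Om : C -> Prop) (phi : C -> C) : Prop :=
  exists phix phiy phixx phixy phiyx phiyy : C -> C,
    partials_on Om phi phix phiy /\
    partials_on Om phix phixx phixy /\
    partials_on Om phiy phiyx phiyy /\
    continuous_on (closure_of Om) phi /\
    continuous_on (closure_of Om) phix /\
    continuous_on (closure_of Om) phiy /\
    continuous_on (closure_of Om) phixx /\
    continuous_on (closure_of Om) phixy /\
    continuous_on (closure_of Om) phiyx /\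
    continuous_on (closure_of Om) phiyy.

Definition recip (f : R -> C) : R -> C := fun r => (/ f r)%C.

Definition radial_solution (Om : C -> Prop) (rho : R) (q f : R -> C) : Prop :=
  let f' := derive_on (Icc 0 rho) f in
  let f'' := derive_on (Icc 0 rho) f' in
  Ck_on 2 (Icc 0 rho) f /\
  (forall r, Icc 0 rho r -> f r <> 0%C) /\
  (forall r, 0 < r < rho ->
     (f'' r + RtoC (1 / r) * f' r - q r * f r = 0)%C) /\
  C2_closure Om (fun z => f (Cmod z)) /\
  f 0 = 1%C /\
  filterlim (fun r => (RtoC r * f' r)%C) (at_right 0) (locally (RtoC 0)).

Definition q_recip (rho : R) (q f : R -> C) : R -> C :=
  fun r =>
    let p := (derive_on (Icc 0 rho) f r / f r)%C in (2 * (p * p) - q r)%C.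

(** The kernel of the transmutation operator with potential [q]; the equation is
    required on the closed rectangle, with one-sided derivatives on its sides. *)
Definition is_kernel (rho : R) (q : R -> C) (G : R -> R -> C) : Prop :=
  C2_rect rho G /\
  (forall r t, Icc 0 rho r -> Icc 0 1 t ->
     (RtoC r * (dr rho (dr rho G) r t - q r * G r t) - dr rho G r t
      + RtoC (2 * (1 - t)) * dt (dr rho G) r t = 0)%C) /\
  (forall r, Icc 0 rho r -> G r 0 = RIntC (fun tau => (RtoC tau * q tau)%C) 0 r) /\
  (forall t, Icc 0 1 t -> G 0 t = 0%C).

Definition Top (G : R -> R -> C) (u : R -> C) : R -> C :=
  fun r =>
    (u r + RIntC (fun s => RtoC s * G r (1 - s ^ 2)%R * u (s ^ 2 * r)%R) 0 1)%C.

(** [Dop_defined] is the differentiability needed for [Dop rho g u r] to be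
    meaningful, for [r] in [[0,rho)]. *)
Definition Dop_defined (rho : R) (g u : R -> C) (r : R) : Prop :=
  ex_derive_on (Ico 0 rho) (fun s => g s * u s)%C r.

Definition Dop (rho : R) (g u : R -> C) : R -> C :=
  fun r => (RtoC r / g r * derive_on (Ico 0 rho) (fun s => g s * u s)%C r)%C.

(* Main.v *)
Require Import Defs.
From Stdlib Require Import Reals Lra ClassicalEpsilon.
From Coquelicot Require Import Coquelicot.
Open Scope R_scope.

(** Write [A] for the kernel of [1/f], [B] for that of [f], and [phi = f' / f]. Inserting
    [A] into [D_f T_(1/f) u], differentiating under the integral sign and integrating by
    parts in the integration variable shows that the first identity holds as soon as
    - [A(r,0) - B(r,0) = - 2 r phi(r)], and
    - [r A_r + r phi A = (A - B) - (1 - t) (A_t - B_t)] for [0 < t < 1];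
    here [s^2/2 (A - B)(r, 1 - s^2) u(s^2 r)] is the antiderivative that carries out the
    integration by parts ([transmutation_relation]). The second identity follows from the
    same argument applied to [1/f], which exchanges [A] and [B] and changes the sign of
    [phi].

    The condition at [t = 0] results from [q_f = phi' + phi^2 + phi/r] and
    [q_(1/f) = phi^2 - phi' - phi/r], which give [(r phi)' = r (q_f - q_(1/f)) / 2]
    ([kernel_diff_at_0]).

    For the condition in the rectangle, set [S = A + B], [H = A - B] and
    - [P = S_r + phi H],
    - [Q = r H_r + r phi S - 2 H + 2 (1 - t) H_t].
    The wanted relation is [r P + Q = 0]. The two second-order equations for [A] and [B]
    turn into the first-order system [r P_r + 2 (1 - t) P_t = P + phi Q],
    [Q_r = r phi P], with [P = 0] for [t = 0] and [Q = 0] for [r = 0]. With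
    [t = 1 - x^2], the curves [r x = c] are characteristics of the first equation, along
    which it reads [d(x P)/dx = - phi Q]. Hence a Gronwall argument gives [P = Q = 0]
    ([char_system_zero], [kernel_relation]).

    The kernels and [u] are differentiable only in the one-sided sense on the boundary of
    their domains. Differential identities are therefore used in the open rectangle and
    carried to the boundary by continuity, through a mean value inequality that needs the
    derivative in the open interval only; only the differentiation of [T u] is done with
    one-sided derivatives, because it includes [r = 0]. *)

(** * Derivatives relative to a set, and their complex-valued calculus *)

Lemma Cmod_le_abs (z : C) : Cmod z <= Rabs (fst z) + Rabs (snd z).
Proof.
  unfold Cmod. pose proof (Rabs_pos (fst z)). pose proof (Rabs_pos (snd z)).
  apply Rsqr_incr_0_var; [|lra].
  rewrite Rsqr_sqrt by nra. rewrite <- (pow2_abs (fst z)), <- (pow2_abs (snd z)).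
  unfold Rsqr. nra.
Qed.

Lemma abs_fst_le (z : C) : Rabs (fst z) <= Cmod z.
Proof. eapply Rle_trans; [|apply Rmax_Cmod]; apply Rmax_l. Qed.

Lemma abs_snd_le (z : C) : Rabs (snd z) <= Cmod z.
Proof. eapply Rle_trans; [|apply Rmax_Cmod]; apply Rmax_r. Qed.

Lemma norm_C_R (z : C) : norm (z : C_R_NormedModule) = Cmod z.
Proof.
  transitivity (sqrt (Rabs (fst z) ^ 2 + Rabs (snd z) ^ 2)); [reflexivity|].
  rewrite !pow2_abs. reflexivity.
Qed.

Lemma Cnorm_sqr_neq_0 (z : C) : z <> 0%C -> fst z ^ 2 + snd z ^ 2 <> 0.
Proof.
  intros H E. apply H. destruct z as [a b]; simpl in *. unfold RtoC. f_equal; nra.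
Qed.

Lemma is_filter_lim_within (D : R -> Prop) (x y : R) :
  D x -> is_filter_lim (within D (locally x)) y -> y = x.
Proof.
  intros Dx H. destruct (Req_dec y x) as [|ne]; [assumption|exfalso].
  assert (p : 0 < Rabs (y - x) / 2) by (pose proof (Rabs_pos_lt (y - x)); lra).
  destruct (H (fun z => Rabs (z - y) < Rabs (y - x) / 2)) as [d Hd].
  { exists (mkposreal _ p). intros z Hz. exact Hz. }
  specialize (Hd x (ball_center x d) Dx). cbv beta in Hd.
  rewrite <- Rabs_Ropp, Ropp_minus_distr in Hd. pose proof (Rabs_pos (y - x)). lra.
Qed.

(** First-order expansion form of [is_derive_on]. *)
Lemma is_derive_on_eps (D : R -> Prop) (f : R -> C) (x : R) (l : C) : D x ->
  (is_derive_on D f x l <->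
   forall eps, 0 < eps -> exists d, 0 < d /\ forall y, D y -> Rabs (y - x) < d ->
     Cmod (f y - f x - RtoC (y - x) * l)%C <= eps * Rabs (y - x)).
Proof.
  intros Dx.
  assert (E : forall y, norm (minus (minus (f y) (f x)) (scal (minus y x) (l : C_R_NormedModule)) : C_R_NormedModule)
     = Cmod (f y - f x - RtoC (y - x) * l)%C).
  { intros y. rewrite norm_C_R. f_equal.
    unfold minus, plus, opp, scal; simpl. unfold prod_plus, prod_opp, prod_scal; simpl.
    unfold plus, opp, scal; simpl. unfold mult; simpl.
    unfold Cminus, Cplus, Copp, Cmult, RtoC; simpl. f_equal; ring. }
  split.
  - intros [_ H] eps He.
    assert (L : is_filter_lim (within D (locally x)) x).
    { intros P HP. apply filter_le_within. exact HP. }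
    destruct (H x L (mkposreal _ He)) as [d Hd].
    exists d. split; [apply cond_pos|]. intros y Dy Hy.
    specialize (Hd y Hy Dy). rewrite <- E. exact Hd.
  - intros H. split.
    + apply (is_linear_scal_l (K := R_AbsRing) (V := C_R_NormedModule)).
    + intros z Hz. apply is_filter_lim_within in Hz; [|assumption]. subst z.
      intros eps. destruct (H eps (cond_pos eps)) as [d [Hd Hy]].
      exists (mkposreal d Hd). intros y By Dy. eapply Rle_trans; [right; exact (E y)|]. apply Hy; [assumption|exact By].
Qed.

Lemma is_derive_eps (f : R -> R) (x l : R) :
  is_derive f x l <->
   forall eps, 0 < eps -> exists d, 0 < d /\ forall y, Rabs (y - x) < d ->
     Rabs (f y - f x - (y - x) * l) <= eps * Rabs (y - x).
Proof.
  split.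
  - intros [_ H] eps He.
    destruct (H x (fun P HP => HP) (mkposreal _ He)) as [d Hd].
    exists d. split; [apply cond_pos|]. exact Hd.
  - intros H. split.
    + apply (is_linear_scal_l (K := R_AbsRing) (V := R_NormedModule)).
    + intros z Hz. apply (is_filter_lim_locally_unique (V := R_NormedModule)) in Hz. rewrite <- Hz.
      intros eps. destruct (H eps (cond_pos eps)) as [d [Hd Hy]].
      exists (mkposreal d Hd). intros y By. apply Hy. exact By.
Qed.

Lemma is_derive_eq (f : R -> R) (x l l' : R) : is_derive f x l -> l = l' -> is_derive f x l'.
Proof. now intros H <-. Qed.

(** Two-sided derivative of a complex-valued function of a real variable, defined
    by components so that the calculus of real derivatives applies to it. *)
Definition cderiv (f : R -> C) (x : R) (l : C) : Prop :=
  is_derive (fun y => fst (f y)) x (fst l) /\ is_derive (fun y => snd (f y)) x (snd l).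

Lemma cderiv_eps (f : R -> C) (x : R) (l : C) :
  cderiv f x l <->
   forall eps, 0 < eps -> exists d, 0 < d /\ forall y, Rabs (y - x) < d ->
     Cmod (f y - f x - RtoC (y - x) * l)%C <= eps * Rabs (y - x).
Proof.
  assert (E1 : forall y, fst (f y - f x - RtoC (y - x) * l)%C = fst (f y) - fst (f x) - (y - x) * fst l)
    by (intros y; simpl; ring).
  assert (E2 : forall y, snd (f y - f x - RtoC (y - x) * l)%C = snd (f y) - snd (f x) - (y - x) * snd l)
    by (intros y; simpl; ring).
  split.
  - intros [H1 H2] eps He. rewrite is_derive_eps in H1, H2.
    assert (He2 : 0 < eps / 2) by lra.
    destruct (H1 _ He2) as [d1 [p1 K1]]. destruct (H2 _ He2) as [d2 [p2 K2]].
    exists (Rmin d1 d2). split; [now apply Rmin_pos|]. intros y Hy.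
    pose proof (Rmin_l d1 d2). pose proof (Rmin_r d1 d2).
    eapply Rle_trans; [apply Cmod_le_abs|]. rewrite E1, E2.
    specialize (K1 y ltac:(lra)). specialize (K2 y ltac:(lra)). lra.
  - intros H. split; apply is_derive_eps; intros eps He; destruct (H eps He) as [d [p K]];
    exists d; (split; [assumption|]); intros y Hy; eapply Rle_trans; [|apply (K y Hy)| |apply (K y Hy)].
    + rewrite <- E1. apply abs_fst_le.
    + rewrite <- E2. apply abs_snd_le.
Qed.

Lemma cderiv_on (D : R -> Prop) (f g : R -> C) (x : R) (l : C) :
  D x -> (forall y, D y -> f y = g y) -> cderiv g x l -> is_derive_on D f x l.
Proof.
  intros Dx E H. rewrite is_derive_on_eps by assumption. intros eps He.
  rewrite cderiv_eps in H. destruct (H eps He) as [d [p K]]. exists d. split; [assumption|].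
  intros y Dy Hy. rewrite !E by assumption. now apply K.
Qed.

(** A derivative relative to [D] is the two-sided derivative of the extension that is
    affine off [D]; this transfers the rules of calculus to one-sided derivatives. *)
Lemma is_derive_on_extend (D : R -> Prop) (f : R -> C) (x : R) (l : C) :
  D x -> is_derive_on D f x l ->
  exists g, cderiv g x l /\ forall y, D y -> g y = f y.
Proof.
  intros Dx H. rewrite is_derive_on_eps in H by assumption.
  exists (fun y => if excluded_middle_informative (D y) then f y
                   else (f x + RtoC (y - x) * l)%C).
  split.
  - apply cderiv_eps. intros eps He. destruct (H eps He) as [d [p K]].
    exists d. split; [assumption|]. intros y Hy.
    destruct (excluded_middle_informative (D x)) as [_|n]; [|contradiction].
    destruct (excluded_middle_informative (D y)) as [Dy|_]; [now apply K|].
    replace (f x + RtoC (y - x) * l - f x - RtoC (y - x) * l)%C with (RtoC 0) by ring.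
    rewrite Cmod_0. apply Rmult_le_pos; [lra|apply Rabs_pos].
  - intros y Dy. now destruct (excluded_middle_informative (D y)).
Qed.

Lemma is_derive_on_interior (D : R -> Prop) (f : R -> C) (x : R) (l : C) :
  (exists d, 0 < d /\ forall y, Rabs (y - x) < d -> D y) ->
  is_derive_on D f x l -> cderiv f x l.
Proof.
  intros [d0 [p0 K0]] H.
  assert (Dx : D x) by (apply K0; rewrite Rminus_diag, Rabs_R0; assumption).
  rewrite is_derive_on_eps in H by assumption. apply cderiv_eps. intros eps He.
  destruct (H eps He) as [d [p K]]. exists (Rmin d d0).
  pose proof (Rmin_l d d0). pose proof (Rmin_r d d0).
  split; [now apply Rmin_pos|]. intros y Hy. apply K; [apply K0|]; lra.
Qed.

Lemma is_derive_cderiv (f : R -> C) (x : R) (l : C) :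
  is_derive (V := C_R_NormedModule) f x l -> cderiv f x l.
Proof.
  intros [L H]. apply (is_derive_on_interior (fun _ => True)).
  { exists 1. split; [lra|trivial]. }
  split; [exact L|]. intros z Hz. apply is_filter_lim_within in Hz; [|exact I]. subst z.
  intros eps. generalize (H x (fun P HP => HP) eps). unfold within. apply filter_imp. intros y Hy _. exact Hy.
Qed.

(** The derivative relative to [D] depends only on the germ of [D] at [x]. *)
Lemma is_derive_on_germ (D D' : R -> Prop) (f : R -> C) (x : R) (l : C) :
  D x -> D' x -> (exists d, 0 < d /\ forall y, Rabs (y - x) < d -> D' y -> D y) ->
  is_derive_on D f x l -> is_derive_on D' f x l.
Proof.
  intros Dx Dx' [d0 [p0 K0]] H.
  rewrite is_derive_on_eps in H |- * by assumption. intros eps He.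
  destruct (H eps He) as [d [p K]]. exists (Rmin d d0).
  pose proof (Rmin_l d d0). pose proof (Rmin_r d d0).
  split; [now apply Rmin_pos|]. intros y Dy Hy. apply K; [apply K0|]; trivial; lra.
Qed.

(** [x] is an accumulation point of [D]. *)
Definition accum (D : R -> Prop) (x : R) : Prop :=
  forall d, 0 < d -> exists y, D y /\ y <> x /\ Rabs (y - x) < d.

(** Needs an accumulation point: at an isolated point of [D] every [l] is a derivative. *)
Lemma is_derive_on_unique (D : R -> Prop) (f : R -> C) (x : R) (l1 l2 : C) :
  D x -> accum D x -> is_derive_on D f x l1 -> is_derive_on D f x l2 -> l1 = l2.
Proof.
  intros Dx Ax H1 H2. rewrite is_derive_on_eps in H1, H2 by assumption.
  assert (Z : forall eps, 0 < eps -> Cmod (l1 - l2)%C <= 2 * eps).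
  { intros eps He. destruct (H1 eps He) as [d1 [p1 K1]]. destruct (H2 eps He) as [d2 [p2 K2]].
    destruct (Ax (Rmin d1 d2)) as [y [Dy [ny Hy]]]; [now apply Rmin_pos|].
    pose proof (Rmin_l d1 d2). pose proof (Rmin_r d1 d2).
    specialize (K1 y Dy ltac:(lra)). specialize (K2 y Dy ltac:(lra)).
    assert (q : 0 < Rabs (y - x)) by (apply Rabs_pos_lt; lra).
    apply Rmult_le_reg_r with (1 := q). rewrite <- Cmod_R, <- Cmod_mult.
    replace ((l1 - l2) * RtoC (y - x))%C with
      ((f y - f x - RtoC (y - x) * l2) + - (f y - f x - RtoC (y - x) * l1))%C by ring.
    eapply Rle_trans; [apply Cmod_triangle|]. rewrite Cmod_opp, Cmod_R. lra. }
  assert (Z0 : Cmod (l1 - l2)%C <= 0).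
  { apply le_epsilon. intros e He. specialize (Z (e / 2) ltac:(lra)). lra. }
  assert (W : (l1 - l2 = 0)%C) by (apply Cmod_eq_0; pose proof (Cmod_ge_0 (l1 - l2)%C); lra).
  replace l1 with ((l1 - l2) + l2)%C by ring. rewrite W. ring.
Qed.

Lemma derive_on_eq (D : R -> Prop) (f : R -> C) (x : R) (l : C) :
  D x -> accum D x -> is_derive_on D f x l -> derive_on D f x = l.
Proof.
  intros Dx Ax H. unfold derive_on. apply (iota_unique (V := C_R_CompleteNormedModule)); [|assumption].
  intros y Hy. now apply (is_derive_on_unique D f x).
Qed.

Lemma derive_on_correct (D : R -> Prop) (f : R -> C) (x : R) :
  D x -> accum D x -> ex_derive_on D f x -> is_derive_on D f x (derive_on D f x).
Proof. intros Dx Ax [l H]. now rewrite (derive_on_eq D f x l). Qed.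

Lemma accum_Icc (a b x : R) : a < b -> Icc a b x -> accum (Icc a b) x.
Proof.
  intros ab [Ha Hb] d p. unfold Icc.
  destruct (Rlt_le_dec x b) as [lt|ge].
  - pose proof (Rmin_l (x + d / 2) b). pose proof (Rmin_r (x + d / 2) b).
    assert (x < Rmin (x + d / 2) b) by (apply Rmin_glb_lt; lra).
    exists (Rmin (x + d / 2) b). rewrite Rabs_pos_eq by lra. lra.
  - pose proof (Rmax_l (x - d / 2) a). pose proof (Rmax_r (x - d / 2) a).
    assert (Rmax (x - d / 2) a < x) by (apply Rmax_lub_lt; lra).
    exists (Rmax (x - d / 2) a). rewrite Rabs_left by lra. lra.
Qed.

Lemma accum_Ico (a b x : R) : Ico a b x -> accum (Ico a b) x.
Proof.
  intros [Ha Hb] d p. unfold Ico.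
  pose proof (Rmin_l (x + d / 2) ((x + b) / 2)). pose proof (Rmin_r (x + d / 2) ((x + b) / 2)).
  assert (x < Rmin (x + d / 2) ((x + b) / 2)) by (apply Rmin_glb_lt; lra).
  exists (Rmin (x + d / 2) ((x + b) / 2)). rewrite Rabs_pos_eq by lra. lra.
Qed.

Lemma Icc_nbhd (a b x : R) : a < x < b ->
  exists d, 0 < d /\ forall y, Rabs (y - x) < d -> Icc a b y.
Proof.
  intros H. exists (Rmin (x - a) (b - x)).
  split; [apply Rmin_pos; lra|]. intros y Hy.
  pose proof (Rmin_l (x - a) (b - x)). pose proof (Rmin_r (x - a) (b - x)).
  apply Rabs_def2 in Hy. unfold Icc. lra.
Qed.

Lemma Icc_cderiv (a b : R) (f : R -> C) (x : R) : a < x < b ->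
  ex_derive_on (Icc a b) f x -> cderiv f x (derive_on (Icc a b) f x).
Proof.
  intros H E. apply (is_derive_on_interior (Icc a b)); [now apply Icc_nbhd|].
  apply derive_on_correct; trivial.
  - unfold Icc; lra.
  - apply accum_Icc; unfold Icc; lra.
Qed.

Lemma cderiv_unique (f : R -> C) (x : R) (l1 l2 : C) :
  cderiv f x l1 -> cderiv f x l2 -> l1 = l2.
Proof.
  intros [H1 H2] [K1 K2].
  apply is_derive_unique in H1, H2, K1, K2.
  destruct l1, l2; simpl in *. congruence.
Qed.

Lemma cderiv_ext_loc (f g : R -> C) (x : R) (l : C) :
  (exists d, 0 < d /\ forall y, Rabs (y - x) < d -> f y = g y) -> cderiv f x l -> cderiv g x l.
Proof.
  intros [d [p K]] [H1 H2]; split.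
  - apply is_derive_ext_loc with (2 := H1). exists (mkposreal d p). intros y Hy. f_equal. now apply K.
  - apply is_derive_ext_loc with (2 := H2). exists (mkposreal d p). intros y Hy. f_equal. now apply K.
Qed.

Lemma cderiv_const (c : C) (x : R) : cderiv (fun _ => c) x 0%C.
Proof. split; apply (is_derive_const (K := R_AbsRing) (V := R_NormedModule)). Qed.

Lemma cderiv_RtoC (f : R -> R) (x l : R) : is_derive f x l -> cderiv (fun y => RtoC (f y)) x (RtoC l).
Proof. intros H; split; [exact H|]. exact (is_derive_const (K := R_AbsRing) (V := R_NormedModule) 0 x). Qed.

Lemma cderiv_id (x : R) : cderiv (fun r => RtoC r) x 1%C.
Proof. apply (cderiv_RtoC (fun z => z) x 1). apply (is_derive_id (K := R_AbsRing)). Qed.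

Lemma cderiv_eq (f : R -> C) (x : R) (l l' : C) : cderiv f x l -> l = l' -> cderiv f x l'.
Proof. now intros H <-. Qed.

Lemma cderiv_plus (f g : R -> C) (x : R) (l m : C) :
  cderiv f x l -> cderiv g x m -> cderiv (fun y => f y + g y)%C x (l + m)%C.
Proof. intros [H1 H2] [K1 K2]; split; simpl; now apply (is_derive_plus (K := R_AbsRing) (V := R_NormedModule)). Qed.

Lemma cderiv_opp (f : R -> C) (x : R) (l : C) :
  cderiv f x l -> cderiv (fun y => - f y)%C x (- l)%C.
Proof. intros [H1 H2]; split; simpl; now apply (is_derive_opp (K := R_AbsRing) (V := R_NormedModule)). Qed.

Lemma cderiv_minus (f g : R -> C) (x : R) (l m : C) :
  cderiv f x l -> cderiv g x m -> cderiv (fun y => f y - g y)%C x (l - m)%C.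
Proof. intros H K. apply cderiv_plus; [assumption|now apply cderiv_opp]. Qed.

Lemma is_derive_Rmult (f g : R -> R) (x l m : R) :
  is_derive f x l -> is_derive g x m -> is_derive (fun y => f y * g y) x (l * g x + f x * m).
Proof. intros H K. apply (is_derive_mult (K := R_AbsRing)); trivial. intros; apply Rmult_comm. Qed.

Lemma cderiv_mult (f g : R -> C) (x : R) (l m : C) :
  cderiv f x l -> cderiv g x m -> cderiv (fun y => f y * g y)%C x (l * g x + f x * m)%C.
Proof.
  intros [H1 H2] [K1 K2]; split; simpl.
  - replace (fst l * fst (g x) - snd l * snd (g x) + (fst (f x) * fst m - snd (f x) * snd m))
      with ((fst l * fst (g x) + fst (f x) * fst m) - (snd l * snd (g x) + snd (f x) * snd m)) by ring.
    apply (is_derive_minus (K := R_AbsRing) (V := R_NormedModule)); now apply is_derive_Rmult.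
  - replace (fst l * snd (g x) + snd l * fst (g x) + (fst (f x) * snd m + snd (f x) * fst m))
      with ((fst l * snd (g x) + fst (f x) * snd m) + (snd l * fst (g x) + snd (f x) * fst m)) by ring.
    apply (is_derive_plus (K := R_AbsRing) (V := R_NormedModule)); now apply is_derive_Rmult.
Qed.

Lemma cderiv_comp (f : R -> C) (h : R -> R) (x m : R) (l : C) :
  cderiv f (h x) l -> is_derive h x m -> cderiv (fun y => f (h y)) x (RtoC m * l)%C.
Proof.
  intros [H1 H2] K; split; simpl.
  - replace (m * fst l - 0 * snd l) with (m * fst l) by ring.
    apply (is_derive_comp (fun y => fst (f y)) h); assumption.
  - replace (m * snd l + 0 * fst l) with (m * snd l) by ring.
    apply (is_derive_comp (fun y => snd (f y)) h); assumption.
Qed.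

Lemma cderiv_inv (f : R -> C) (x : R) (l : C) : f x <> 0%C ->
  cderiv f x l -> cderiv (fun y => / f y)%C x (- l / (f x * f x))%C.
Proof.
  intros nz [H1 H2].
  pose proof (Cnorm_sqr_neq_0 _ nz) as N.
  assert (G : forall a b : R -> R, forall a' b' : R, a x ^ 2 + b x ^ 2 <> 0 ->
    is_derive a x a' -> is_derive b x b' ->
    is_derive (fun y => a y / (a y ^ 2 + b y ^ 2)) x
      ((a' * (b x ^ 2 - a x ^ 2) - 2 * a x * b x * b') / (a x ^ 2 + b x ^ 2) ^ 2) ).
  { intros a b a' b' n Ha Hb.
    assert (Da := is_derive_unique _ _ _ Ha). assert (Db := is_derive_unique _ _ _ Hb).
    simpl in n. auto_derive; [repeat split; trivial; eexists; eassumption|].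
    change (Derive (fun y => a y) x) with (Derive a x).
    change (Derive (fun y => b y) x) with (Derive b x).
    rewrite Da, Db. field. exact n. }
  split.
  - eapply is_derive_eq.
    + apply (G (fun y => fst (f y)) (fun y => snd (f y))); eassumption.
    + simpl in N |- *. field. simpl. repeat split; nra.
  - eapply is_derive_eq.
    + apply (is_derive_ext (fun y => - (snd (f y) / (snd (f y) ^ 2 + fst (f y) ^ 2)))).
      { intros y. simpl. unfold Rdiv. rewrite (Rplus_comm (snd (f y) * _)). ring. }
      apply (is_derive_opp (K := R_AbsRing) (V := R_NormedModule)).
      apply (G (fun y => snd (f y)) (fun y => fst (f y))); try eassumption. lra.
    + unfold opp; simpl in N |- *. field. simpl. repeat split; nra.
Qed.

Lemma is_derive_on_eq (D : R -> Prop) (f : R -> C) (x : R) (l l' : C) :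
  is_derive_on D f x l -> l = l' -> is_derive_on D f x l'.
Proof. now intros H <-. Qed.

Lemma is_derive_on_ext (D : R -> Prop) (f g : R -> C) (x : R) (l : C) : D x ->
  (forall y, D y -> f y = g y) -> is_derive_on D f x l -> is_derive_on D g x l.
Proof.
  intros Dx E H. destruct (is_derive_on_extend D f x l Dx H) as [f1 [F1 Ef]].
  apply (cderiv_on D _ f1); trivial. intros y Dy. now rewrite Ef, E.
Qed.

Lemma is_derive_on_const (D : R -> Prop) (c : C) (x : R) : D x -> is_derive_on D (fun _ => c) x 0%C.
Proof. intros Dx. apply (cderiv_on D _ (fun _ => c)); trivial. apply cderiv_const. Qed.

Lemma is_derive_on_plus (D : R -> Prop) (f g : R -> C) (x : R) (l m : C) : D x ->
  is_derive_on D f x l -> is_derive_on D g x m ->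
  is_derive_on D (fun y => f y + g y)%C x (l + m)%C.
Proof.
  intros Dx Hf Hg. destruct (is_derive_on_extend D f x l Dx Hf) as [f1 [F1 Ef]].
  destruct (is_derive_on_extend D g x m Dx Hg) as [g1 [G1 Eg]].
  apply (cderiv_on D _ (fun y => f1 y + g1 y)%C); trivial.
  - intros y Dy. now rewrite Ef, Eg.
  - now apply cderiv_plus.
Qed.

Lemma is_derive_on_mult (D : R -> Prop) (f g : R -> C) (x : R) (l m : C) : D x ->
  is_derive_on D f x l -> is_derive_on D g x m ->
  is_derive_on D (fun y => f y * g y)%C x (l * g x + f x * m)%C.
Proof.
  intros Dx Hf Hg. destruct (is_derive_on_extend D f x l Dx Hf) as [f1 [F1 Ef]].
  destruct (is_derive_on_extend D g x m Dx Hg) as [g1 [G1 Eg]].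
  apply (cderiv_on D _ (fun y => f1 y * g1 y)%C); trivial.
  - intros y Dy. now rewrite Ef, Eg.
  - rewrite <- (Ef x Dx), <- (Eg x Dx). now apply cderiv_mult.
Qed.

Lemma is_derive_on_comp_scale (D D' : R -> Prop) (f : R -> C) (k x : R) (l : C) :
  D (k * x) -> D' x -> (forall y, D' y -> D (k * y)) ->
  is_derive_on D f (k * x) l -> is_derive_on D' (fun y => f (k * y)) x (RtoC k * l)%C.
Proof.
  intros Dx Dx' S Hf. destruct (is_derive_on_extend D f _ l Dx Hf) as [f1 [F1 Ef]].
  apply (cderiv_on D' _ (fun y => f1 (k * y))); trivial.
  - intros y Dy. symmetry. apply Ef. now apply S.
  - apply (cderiv_comp f1 (fun y => k * y)); [assumption|]. auto_derive; [trivial|ring].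
Qed.

Lemma is_derive_on_recip (D : R -> Prop) (f : R -> C) (x : R) (l : C) : D x -> f x <> 0%C ->
  is_derive_on D f x l -> is_derive_on D (recip f) x (- l / (f x * f x))%C.
Proof.
  intros Dx nz Hf. destruct (is_derive_on_extend D f x l Dx Hf) as [f1 [F1 Ef]].
  apply (cderiv_on D _ (recip f1)); trivial.
  - intros y Dy. unfold recip. now rewrite Ef.
  - rewrite <- (Ef x Dx). apply cderiv_inv; [now rewrite Ef|assumption].
Qed.

(** * Continuity relative to a set *)

Lemma continuous_Cpair {U : UniformSpace} (f : U -> C) (x : U) :
  continuous (fun y => fst (f y)) x -> continuous (fun y => snd (f y)) x -> continuous f x.
Proof.
  intros H1 H2. apply (continuous_ext (fun y => (fst (f y), snd (f y)))).
  - intros y. now rewrite <- surjective_pairing.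
  - intros P [d Hd].
    assert (L1 : locally x (fun y => ball (fst (f x)) d (fst (f y)))) by (apply H1, locally_ball).
    assert (L2 : locally x (fun y => ball (snd (f x)) d (snd (f y)))) by (apply H2, locally_ball).
    generalize (filter_and _ _ L1 L2). unfold filtermap. apply filter_imp. intros y [B1 B2].
    apply Hd. split; assumption.
Qed.

Lemma continuous_Cfst {U : UniformSpace} (f : U -> C) (x : U) :
  continuous f x -> continuous (fun y => fst (f y)) x.
Proof. intros H. apply (continuous_comp f fst); [assumption|]. apply continuous_fst. Qed.

Lemma continuous_Csnd {U : UniformSpace} (f : U -> C) (x : U) :
  continuous f x -> continuous (fun y => snd (f y)) x.
Proof. intros H. apply (continuous_comp f snd); [assumption|]. apply continuous_snd. Qed.

Lemma continuous_RtoC {U : UniformSpace} (f : U -> R) (x : U) :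
  continuous f x -> continuous (fun y => RtoC (f y)) x.
Proof. intros H. apply continuous_Cpair; [exact H|]. apply continuous_const. Qed.

Lemma continuous_Cplus {U : UniformSpace} (f g : U -> C) (x : U) :
  continuous f x -> continuous g x -> continuous (fun y => f y + g y)%C x.
Proof.
  intros H K. apply continuous_Cpair.
  - exact (continuous_plus (V := R_NormedModule) _ _ x (continuous_Cfst f x H) (continuous_Cfst g x K)).
  - exact (continuous_plus (V := R_NormedModule) _ _ x (continuous_Csnd f x H) (continuous_Csnd g x K)).
Qed.

Lemma continuous_Copp {U : UniformSpace} (f : U -> C) (x : U) :
  continuous f x -> continuous (fun y => - f y)%C x.
Proof.
  intros H. apply continuous_Cpair.
  - exact (continuous_opp (V := R_NormedModule) _ x (continuous_Cfst f x H)).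
  - exact (continuous_opp (V := R_NormedModule) _ x (continuous_Csnd f x H)).
Qed.

Lemma continuous_Cminus {U : UniformSpace} (f g : U -> C) (x : U) :
  continuous f x -> continuous g x -> continuous (fun y => f y - g y)%C x.
Proof. intros H K. exact (continuous_Cplus _ _ x H (continuous_Copp _ x K)). Qed.

Lemma continuous_Cmult {U : UniformSpace} (f g : U -> C) (x : U) :
  continuous f x -> continuous g x -> continuous (fun y => f y * g y)%C x.
Proof.
  intros H K.
  assert (f1 := continuous_Cfst f x H). assert (f2 := continuous_Csnd f x H).
  assert (g1 := continuous_Cfst g x K). assert (g2 := continuous_Csnd g x K).
  apply continuous_Cpair.
  - exact (continuous_minus (V := R_NormedModule) _ _ x
      (continuous_mult (K := R_AbsRing) _ _ x f1 g1) (continuous_mult (K := R_AbsRing) _ _ x f2 g2)).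
  - exact (continuous_plus (V := R_NormedModule) _ _ x
      (continuous_mult (K := R_AbsRing) _ _ x f1 g2) (continuous_mult (K := R_AbsRing) _ _ x f2 g1)).
Qed.

Lemma cderiv_continuous (f : R -> C) (x : R) (l : C) : cderiv f x l -> continuous f x.
Proof.
  intros [H1 H2]. apply continuous_Cpair; apply (ex_derive_continuous (K := R_AbsRing) (V := R_NormedModule));
  eexists; eassumption.
Qed.

Lemma is_derive_on_continuous (D : R -> Prop) (f : R -> C) (x : R) (l : C) :
  D x -> is_derive_on D f x l -> filterlim f (within D (locally x)) (locally (f x)).
Proof.
  intros Dx H. destruct (is_derive_on_extend D f x l Dx H) as [g [K E]].
  apply cderiv_continuous in K. rewrite <- E by assumption.
  intros P HP. specialize (K P HP). unfold filtermap, within in *.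
  revert K. apply filter_imp. intros y Py Dy. now rewrite <- E.
Qed.

Lemma Ck_on_1_continuous_on (D : R -> Prop) (f : R -> C) : Ck_on 1 D f -> continuous_on D f.
Proof.
  intros [H _] x Dx. destruct (H x Dx) as [l Hl]. now apply (is_derive_on_continuous D f x l).
Qed.

Lemma continuous_on_Cext {U : UniformSpace} (D : U -> Prop) (f g : U -> C) :
  (forall x, D x -> f x = g x :> C) -> continuous_on D f -> continuous_on D g.
Proof.
  intros E H x Dx P HP. rewrite <- E in HP by assumption. specialize (H x Dx P HP).
  unfold filtermap, within in *. revert H. apply filter_imp. intros y Py Dy.
  rewrite <- E by assumption. now apply Py.
Qed.

Lemma continuous_continuous_on {U V : UniformSpace} (D : U -> Prop) (f : U -> V) :
  (forall x, D x -> continuous f x) -> continuous_on D f.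
Proof. intros H x Dx. apply filterlim_filter_le_1 with (2 := H x Dx). apply filter_le_within. Qed.

Lemma continuous_on_subset {U V : UniformSpace} (D D' : U -> Prop) (f : U -> V) :
  (forall x, D' x -> D x) -> continuous_on D f -> continuous_on D' f.
Proof.
  intros S H x Dx P HP. specialize (H x (S x Dx) P HP). unfold filtermap, within in *.
  revert H. apply filter_imp. intros y Py Dy. apply Py. now apply S.
Qed.

Lemma continuous_on_interior {U V : UniformSpace} (D : U -> Prop) (f : U -> V) (x : U) :
  locally x D -> continuous_on D f -> continuous f x.
Proof.
  intros L H P HP. specialize (H x (locally_singleton _ _ L) P HP). unfold filtermap, within in *.
  generalize (filter_and _ _ L H). apply filter_imp. intros y [Dy Py]. now apply Py.
Qed.

Lemma continuous_on_const {U V : UniformSpace} (D : U -> Prop) (c : V) : continuous_on D (fun _ => c).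
Proof. apply continuous_continuous_on. intros x _. apply continuous_const. Qed.

Lemma continuous_on_id_RtoC (D : R -> Prop) : continuous_on D (fun r => RtoC r).
Proof. apply continuous_continuous_on. intros x _. apply continuous_RtoC, continuous_id. Qed.

Lemma filterlim_Cop2 (op : C -> C -> C) (x y : C) :
  continuous (fun p : C * C => op (fst p) (snd p)) (x, y) ->
  filterlim (fun p : C * C => op (fst p) (snd p)) (filter_prod (locally x) (locally y)) (locally (op x y)).
Proof.
  intros K P HP. destruct (K P HP) as [d Kd].
  exists (ball x d) (ball y d); try apply locally_ball.
  intros u v Hu Hv. apply (Kd (u, v)). now split.
Qed.

Lemma continuous_on_Cplus {U : UniformSpace} (D : U -> Prop) (f g : U -> C) :
  continuous_on D f -> continuous_on D g -> continuous_on D (fun x => f x + g x)%C.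
Proof.
  intros Hf Hg x Dx. eapply (filterlim_comp_2 f g Cplus); [exact (Hf x Dx)|exact (Hg x Dx)|].
  apply filterlim_Cop2. apply continuous_Cplus; [apply continuous_fst|apply continuous_snd].
Qed.

Lemma continuous_on_Cminus {U : UniformSpace} (D : U -> Prop) (f g : U -> C) :
  continuous_on D f -> continuous_on D g -> continuous_on D (fun x => f x - g x)%C.
Proof.
  intros Hf Hg x Dx. eapply (filterlim_comp_2 f g Cminus); [exact (Hf x Dx)|exact (Hg x Dx)|].
  apply filterlim_Cop2. apply continuous_Cminus; [apply continuous_fst|apply continuous_snd].
Qed.

Lemma continuous_on_Cmult {U : UniformSpace} (D : U -> Prop) (f g : U -> C) :
  continuous_on D f -> continuous_on D g -> continuous_on D (fun x => f x * g x)%C.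
Proof.
  intros Hf Hg x Dx. eapply (filterlim_comp_2 f g Cmult); [exact (Hf x Dx)|exact (Hg x Dx)|].
  apply filterlim_Cop2. apply continuous_Cmult; [apply continuous_fst|apply continuous_snd].
Qed.

Lemma continuous_on_Cinv {U : UniformSpace} (D : U -> Prop) (f : U -> C) :
  (forall x, D x -> f x <> 0%C) -> continuous_on D f -> continuous_on D (fun x => / f x)%C.
Proof.
  intros nz Hf x Dx.
  apply filterlim_comp with (1 := Hf x Dx).
  pose proof (Cnorm_sqr_neq_0 _ (nz x Dx)) as N. simpl in N.
  change (continuous Cinv (f x)).
  assert (c1 : continuous (fun z : C => fst z) (f x)) by (destruct (f x); apply continuous_fst).
  assert (c2 : continuous (fun z : C => snd z) (f x)) by (destruct (f x); apply continuous_snd).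
  assert (cd : continuous (fun z : C => / (fst z * fst z + snd z * snd z)) (f x)).
  { apply (continuous_comp (fun z : C => fst z * fst z + snd z * snd z) Rinv).
    - apply (continuous_plus (V := R_NormedModule)); now apply (continuous_mult (K := R_AbsRing)).
    - apply (ex_derive_continuous (K := R_AbsRing) (V := R_NormedModule)). auto_derive. lra. }
  apply continuous_Cpair.
  - apply (continuous_ext (fun z : C => fst z * / (fst z * fst z + snd z * snd z))).
    { intros z. simpl. now rewrite !Rmult_1_r. }
    now apply (continuous_mult (K := R_AbsRing)).
  - apply (continuous_ext (fun z : C => - snd z * / (fst z * fst z + snd z * snd z))).
    { intros z. simpl. now rewrite !Rmult_1_r. }
    apply (continuous_mult (K := R_AbsRing)); [|assumption]. now apply (continuous_opp (V := R_NormedModule)).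
Qed.

(** The point of [[a,b]] closest to [x]. Composing with it turns a function continuous
    relative to [[a,b]] into one continuous on the whole line. *)
Definition clamp (a b x : R) : R := Rmax a (Rmin x b).

Lemma clamp_in (a b x : R) : a <= b -> a <= clamp a b x <= b.
Proof.
  intros H. unfold clamp. pose proof (Rmin_r x b). split; [apply Rmax_l|].
  apply Rmax_lub; assumption.
Qed.

Lemma clamp_id (a b x : R) : a <= x <= b -> clamp a b x = x.
Proof. intros [H K]. unfold clamp. rewrite Rmin_left by assumption. now apply Rmax_right. Qed.

Lemma clamp_lip (a b x y : R) : a <= b -> Rabs (clamp a b x - clamp a b y) <= Rabs (x - y).
Proof.
  intros H. unfold clamp, Rmax, Rmin.
  repeat destruct Rle_dec; unfold Rabs; repeat destruct Rcase_abs; lra.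
Qed.

Lemma continuous_clamp (a b x : R) : a <= b -> continuous (clamp a b) x.
Proof.
  intros H P [d Hd]. exists d. intros y Hy. apply Hd.
  eapply Rle_lt_trans; [apply clamp_lip; assumption|exact Hy].
Qed.

Lemma continuous_on_clamp {V : UniformSpace} (a b : R) (f : R -> V) (x : R) : a <= b ->
  continuous_on (Icc a b) f -> continuous (fun y => f (clamp a b y)) x.
Proof.
  intros ab H. unfold continuous.
  apply filterlim_comp with (2 := H (clamp a b x) (clamp_in a b x ab)).
  intros P HP. unfold within in HP.
  generalize (continuous_clamp a b x ab _ HP). unfold filtermap.
  apply filter_imp. intros y Py. apply Py. now apply clamp_in.
Qed.

Lemma clamp_locally (a b x : R) : a < x < b ->
  exists d, 0 < d /\ forall y, Rabs (y - x) < d -> clamp a b y = y.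
Proof.
  intros H. destruct (Icc_nbhd a b x H) as [d [p K]]. exists d. split; [assumption|].
  intros y Hy. apply clamp_id. now apply K.
Qed.

(** * Continuous functions on a rectangle *)

(** The closed rectangle [[a,b] x [c,d]]. *)
Definition rect (a b c d : R) (p : R * R) : Prop := Icc a b (fst p) /\ Icc c d (snd p).

Lemma rect_interior (a b c d r t : R) : a < r < b -> c < t < d ->
  locally (r, t) (fun p : R * R => a < fst p < b /\ c < snd p < d).
Proof.
  intros Hr Ht.
  assert (p1 : 0 < Rmin (Rmin (r - a) (b - r)) (Rmin (t - c) (d - t))).
  { repeat apply Rmin_pos; lra. }
  exists (mkposreal _ p1). intros [x y] [B1 B2]. simpl in *.
  change (Rabs (x - r) < Rmin (Rmin (r - a) (b - r)) (Rmin (t - c) (d - t))) in B1.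
  change (Rabs (y - t) < Rmin (Rmin (r - a) (b - r)) (Rmin (t - c) (d - t))) in B2.
  apply Rabs_def2 in B1, B2.
  pose proof (Rmin_l (Rmin (r - a) (b - r)) (Rmin (t - c) (d - t))).
  pose proof (Rmin_r (Rmin (r - a) (b - r)) (Rmin (t - c) (d - t))).
  pose proof (Rmin_l (r - a) (b - r)). pose proof (Rmin_r (r - a) (b - r)).
  pose proof (Rmin_l (t - c) (d - t)). pose proof (Rmin_r (t - c) (d - t)). lra.
Qed.

Lemma continuous_on_rect_interior (a b c d : R) (F : R * R -> C) (r t : R) :
  a < r < b -> c < t < d -> continuous_on (rect a b c d) F -> continuous F (r, t).
Proof.
  intros Hr Ht. apply continuous_on_interior.
  generalize (rect_interior a b c d r t Hr Ht). apply filter_imp.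
  intros p Hp. unfold rect, Icc. lra.
Qed.

Lemma rect_slice_r (a b c d : R) (F : R -> R -> C) (r : R) : Icc a b r ->
  continuous_on (rect a b c d) (fun p => F (fst p) (snd p)) ->
  continuous_on (Icc c d) (F r).
Proof.
  intros Hr H s Hs P HP. specialize (H (r, s) (conj Hr Hs) P HP). destruct H as [e He].
  exists e. intros y By Dy. apply (He (r, y)).
  - split; [apply ball_center|exact By].
  - now split.
Qed.

Lemma rect_slice_t (a b c d : R) (F : R -> R -> C) (t : R) : Icc c d t ->
  continuous_on (rect a b c d) (fun p => F (fst p) (snd p)) ->
  continuous_on (Icc a b) (fun r => F r t).
Proof.
  intros Ht H s Hs P HP. specialize (H (s, t) (conj Hs Ht) P HP). destruct H as [e He].
  exists e. intros y By Dy. apply (He (y, t)).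
  - split; [exact By|apply ball_center].
  - now split.
Qed.

Lemma continuous_on_fst (a b c d : R) (f : R -> C) :
  continuous_on (Icc a b) f -> continuous_on (rect a b c d) (fun p => f (fst p)).
Proof.
  intros H p [Dp _] P HP. destruct (H (fst p) Dp P HP) as [e He].
  exists e. intros q [Bq _] [Dq _]. now apply He.
Qed.

(** Joint continuity on the whole plane of a curried function of two variables. *)
Definition cont2 (F : R -> R -> C) : Prop :=
  forall p : R * R, continuous (fun p => F (fst p) (snd p)) p.

Lemma cont2_comp {U : UniformSpace} (F : R -> R -> C) (h k : U -> R) (x : U) :
  cont2 F -> continuous h x -> continuous k x -> continuous (fun y => F (h y) (k y)) x.
Proof.
  intros H Hh Hk.
  now apply (continuous_comp_2 h k (fun a b => F a b)).
Qed.

Lemma cont2_clamp (a b c d : R) (G : R -> R -> C) : a <= b -> c <= d ->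
  continuous_on (rect a b c d) (fun p => G (fst p) (snd p)) ->
  cont2 (fun r t => G (clamp a b r) (clamp c d t)).
Proof.
  intros ab cd H p. unfold continuous.
  set (k := fun p : R * R => (clamp a b (fst p), clamp c d (snd p))).
  assert (kin : forall q, rect a b c d (k q)).
  { intros q. split; simpl; now apply clamp_in. }
  assert (kc : continuous k p).
  { intros P [e He].
    assert (L1 : locally p (fun q : R * R => ball (clamp a b (fst p)) e (clamp a b (fst q)))).
    { apply (continuous_comp fst (clamp a b) p (continuous_fst (fst p) (snd p)) (continuous_clamp a b _ ab) _ (locally_ball _ e)). }
    assert (L2 : locally p (fun q : R * R => ball (clamp c d (snd p)) e (clamp c d (snd q)))).
    { apply (continuous_comp snd (clamp c d) p (continuous_snd (fst p) (snd p)) (continuous_clamp c d _ cd) _ (locally_ball _ e)). }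
    generalize (filter_and _ _ L1 L2). unfold filtermap. apply filter_imp. intros q [B1 B2]. apply He. now split. }
  change (filterlim (fun q => (fun p => G (fst p) (snd p)) (k q)) (locally p) (locally ((fun p => G (fst p) (snd p)) (k p)))).
  apply filterlim_comp with (2 := H (k p) (kin p)).
  intros P HP. generalize (kc _ HP). unfold filtermap, within.
  apply filter_imp. intros y Py. apply Py, kin.
Qed.

Lemma cont2_uniform (F : R -> R -> C) (a b c d : R) : cont2 F ->
  forall eps, 0 < eps -> exists del, 0 < del /\ forall x y u v,
    a <= x <= b -> c <= y <= d -> a <= u <= b -> c <= v <= d ->
    Rabs (u - x) < del -> Rabs (v - y) < del -> Cmod (F u v - F x y)%C <= eps.
Proof.
  intros H eps He. assert (He2 : 0 < eps / 2) by lra.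
  destruct (uniform_continuity_2d (fun x y => fst (F x y)) a b c d) with (eps := mkposreal _ He2) as [d1 K1].
  { intros x y _ _. apply continuity_2d_pt_filterlim.
    apply (continuous_Cfst (fun p : R * R => F (fst p) (snd p)) (x, y)). apply H. }
  destruct (uniform_continuity_2d (fun x y => snd (F x y)) a b c d) with (eps := mkposreal _ He2) as [d2 K2].
  { intros x y _ _. apply continuity_2d_pt_filterlim.
    apply (continuous_Csnd (fun p : R * R => F (fst p) (snd p)) (x, y)). apply H. }
  simpl in K1, K2. exists (Rmin d1 d2). pose proof (Rmin_l d1 d2). pose proof (Rmin_r d1 d2).
  split; [apply Rmin_pos; apply cond_pos|]. intros x y u v Hx Hy Hu Hv Hux Hvy.
  specialize (K1 x y u v Hx Hy Hu Hv ltac:(lra) ltac:(lra)).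
  specialize (K2 x y u v Hx Hy Hu Hv ltac:(lra) ltac:(lra)).
  eapply Rle_trans; [apply Cmod_le_abs|]. simpl. unfold Rminus in K1, K2. lra.
Qed.

(** Uniform continuity bounds the variation along a chain of [n] short steps that
    joins the corner [(a,c)] to any point of the rectangle. *)
Lemma cont2_bounded (F : R -> R -> C) (a b c d : R) : a <= b -> c <= d -> cont2 F ->
  exists M, 0 < M /\ forall x y, a <= x <= b -> c <= y <= d -> Cmod (F x y) <= M.
Proof.
  intros ab cd H. destruct (cont2_uniform F a b c d H 1 Rlt_0_1) as [e [pe K]].
  assert (St : forall n x y, a <= x <= b -> c <= y <= d -> x - a <= INR n * (e / 2) -> y - c <= INR n * (e / 2) ->
     Cmod (F x y) <= Cmod (F a c) + INR n).
  { induction n as [|n IH]; intros x y Hx Hy Lx Ly.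
    - simpl in *. replace x with a by lra. replace y with c by lra. lra.
    - rewrite S_INR in *.
      set (x' := Rmax a (x - e / 2)). set (y' := Rmax c (y - e / 2)).
      assert (Hx' : a <= x' <= x /\ x - x' <= e / 2 /\ x' - a <= INR n * (e / 2)).
      { unfold x', Rmax. pose proof (pos_INR n). destruct Rle_dec; nra. }
      assert (Hy' : c <= y' <= y /\ y - y' <= e / 2 /\ y' - c <= INR n * (e / 2)).
      { unfold y', Rmax. pose proof (pos_INR n). destruct Rle_dec; nra. }
      assert (IH' := IH x' y' ltac:(lra) ltac:(lra) ltac:(lra) ltac:(lra)).
      assert (K' : Cmod (F x y - F x' y')%C <= 1).
      { apply K; try lra; rewrite Rabs_pos_eq; lra. }
      replace (F x y) with ((F x y - F x' y') + F x' y')%C by ring.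
      eapply Rle_trans; [apply Cmod_triangle|]. lra. }
  destruct (nfloor_ex ((b - a + (d - c)) / (e / 2))) as [n [_ Hn]].
  { apply Rmult_le_pos; [lra|]. left. apply Rinv_0_lt_compat. lra. }
  exists (Cmod (F a c) + INR (S n)). split.
  - rewrite S_INR. pose proof (Cmod_ge_0 (F a c)). pose proof (pos_INR n). lra.
  - intros x y Hx Hy.
    assert (L : b - a + (d - c) <= INR (S n) * (e / 2)).
    { rewrite S_INR.
      apply Rlt_le in Hn. apply (Rmult_le_compat_r (e / 2)) in Hn; [|lra].
      unfold Rdiv at 1 in Hn. rewrite Rmult_assoc, Rinv_l in Hn by lra. lra. }
    apply St; lra.
Qed.

(** * Mean value inequality *)

Lemma deriv_nonpos_decr (f f' : R -> R) (a b : R) : a <= b ->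
  (forall x, a <= x <= b -> continuous f x) ->
  (forall x, a < x < b -> is_derive f x (f' x) /\ f' x <= 0) ->
  f b <= f a.
Proof.
  intros ab Hc Hd.
  (* [f'] is irrelevant at the end points, where [0] replaces it *)
  set (d := fun x => if Rlt_dec a x then (if Rlt_dec x b then f' x else 0) else 0).
  destruct (MVT_gen f a b d) as [c [_ E]].
  - rewrite Rmin_left, Rmax_right by assumption. intros x Hx. unfold d.
    destruct (Rlt_dec a x); [|lra]. destruct (Rlt_dec x b); [|lra]. now apply Hd.
  - rewrite Rmin_left, Rmax_right by assumption. intros x Hx.
    apply continuity_pt_filterlim. now apply Hc.
  - assert (d c <= 0); [|nra]. unfold d. destruct (Rlt_dec a c); [|lra]. destruct (Rlt_dec c b); [|lra].
    apply Hd; lra.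
Qed.

(** If [|f'|] is at most the derivative of [g] in the open interval, then the increment
    of [f] is at most twice that of [g]; the factor [2] comes from bounding the two
    components separately. *)
Lemma mean_value_ineq (f f' : R -> C) (g g' : R -> R) (a b : R) : a <= b ->
  continuous_on (Icc a b) f ->
  (forall x, a <= x <= b -> continuous g x) ->
  (forall x, a < x < b -> cderiv f x (f' x) /\ is_derive g x (g' x) /\ Cmod (f' x) <= g' x) ->
  Cmod (f b - f a)%C <= 2 * (g b - g a).
Proof.
  intros ab Hf Hg Hd.
  set (F := fun x => f (clamp a b x)).
  assert (Fa : F a = f a) by (unfold F; rewrite clamp_id; [reflexivity|lra]).
  assert (Fb : F b = f b) by (unfold F; rewrite clamp_id; [reflexivity|lra]).
  assert (cF : forall x, continuous F x) by (intros x; now apply continuous_on_clamp).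
  assert (dF : forall x, a < x < b -> cderiv F x (f' x)).
  { intros x Hx. apply (cderiv_ext_loc f); [|now apply Hd].
    destruct (clamp_locally a b x Hx) as [d [p K]]. exists d. split; [assumption|].
    intros y Hy. unfold F. now rewrite K. }
  assert (key : forall h h' : R -> R, (forall x, continuous h x) ->
     (forall x, a < x < b -> is_derive h x (h' x) /\ Rabs (h' x) <= g' x) ->
     Rabs (h b - h a) <= g b - g a).
  { intros h h' ch dh. apply Rabs_le. split.
    - cut (- h b - g b <= - h a - g a); [lra|].
      apply (deriv_nonpos_decr (fun x => - h x - g x) (fun x => - h' x - g' x)); trivial.
      + intros x Hx. apply (continuous_minus (V := R_NormedModule)); [|now apply Hg].
        apply (continuous_opp (V := R_NormedModule)). apply ch.
      + intros x Hx. destruct (dh x Hx) as [A B]. destruct (Hd x Hx) as [_ [A' _]]. split.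
        * apply (is_derive_minus (K := R_AbsRing) (V := R_NormedModule)); trivial.
          now apply (is_derive_opp (K := R_AbsRing) (V := R_NormedModule)).
        * apply Rabs_le_between in B. lra.
    - cut (h b - g b <= h a - g a); [lra|].
      apply (deriv_nonpos_decr (fun x => h x - g x) (fun x => h' x - g' x)); trivial.
      + intros x Hx. apply (continuous_minus (V := R_NormedModule)); [|now apply Hg]. apply ch.
      + intros x Hx. destruct (dh x Hx) as [A B]. destruct (Hd x Hx) as [_ [A' _]]. split.
        * now apply (is_derive_minus (K := R_AbsRing) (V := R_NormedModule)).
        * apply Rabs_le_between in B. lra. }
  rewrite <- Fa, <- Fb. eapply Rle_trans; [apply Cmod_le_abs|].
  assert (K1 : Rabs (fst (F b) - fst (F a)) <= g b - g a).
  { apply (key (fun x => fst (F x)) (fun x => fst (f' x))).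
    - intros x. apply (continuous_Cfst F), cF.
    - intros x Hx. split; [apply (dF x Hx)|]. eapply Rle_trans; [apply abs_fst_le|]. now apply Hd. }
  assert (K2 : Rabs (snd (F b) - snd (F a)) <= g b - g a).
  { apply (key (fun x => snd (F x)) (fun x => snd (f' x))).
    - intros x. apply (continuous_Csnd F), cF.
    - intros x Hx. split; [apply (dF x Hx)|]. eapply Rle_trans; [apply abs_snd_le|]. now apply Hd. }
  simpl. unfold Rminus in K1, K2. lra.
Qed.

Lemma deriv_zero_const (f : R -> C) (a b : R) : a <= b ->
  continuous_on (Icc a b) f -> (forall x, a < x < b -> cderiv f x 0%C) -> f b = f a.
Proof.
  intros ab Hf Hd.
  assert (K : Cmod (f b - f a)%C <= 2 * (0 - 0)).
  { apply (mean_value_ineq f (fun _ => RtoC 0) (fun _ => 0) (fun _ => 0)); trivial.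
    - intros x _. apply continuous_const.
    - intros x Hx. split; [now apply Hd|split].
      + apply (is_derive_const (K := R_AbsRing) (V := R_NormedModule)).
      + cbv beta. rewrite Cmod_0. lra. }
  assert (W : (f b - f a = 0)%C) by (apply Cmod_eq_0; pose proof (Cmod_ge_0 (f b - f a)%C); lra).
  replace (f b) with ((f b - f a) + f a)%C by ring. rewrite W. ring.
Qed.

(** Mean value inequality for the distance of [f] from an affine function of slope [l]. *)
Lemma mean_value_affine (f f' : R -> C) (l : C) (x y e : R) : 0 <= e ->
  (forall z, Rmin x y <= z <= Rmax x y ->
     is_derive_on (Icc (Rmin x y) (Rmax x y)) f z (f' z) /\ Cmod (f' z - l)%C <= e) ->
  Cmod (f y - f x - RtoC (y - x) * l)%C <= 2 * e * Rabs (y - x).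
Proof.
  intros He H.
  assert (key : forall a b, a <= b ->
    (forall z, a <= z <= b -> is_derive_on (Icc a b) f z (f' z) /\ Cmod (f' z - l)%C <= e) ->
    Cmod ((f b - RtoC b * l) - (f a - RtoC a * l))%C <= 2 * (e * b - e * a)).
  { intros a b ab K.
    assert (Kon : forall z, a <= z <= b ->
       is_derive_on (Icc a b) (fun z => f z - RtoC z * l)%C z (f' z - l)%C).
    { intros z Hz. destruct (K z Hz) as [K1 _].
      destruct (is_derive_on_extend _ f z _ Hz K1) as [g [Kg Eg]].
      apply (cderiv_on _ _ (fun z => g z - RtoC z * l)%C); [assumption| |].
      - intros w Dw. now rewrite Eg.
      - eapply cderiv_eq.
        + apply cderiv_minus; [exact Kg|]. apply cderiv_mult; [|apply cderiv_const].
          apply (cderiv_RtoC (fun z => z) z 1). apply (is_derive_id (K := R_AbsRing)).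
        + cbv beta. ring. }
    apply (mean_value_ineq (fun z => f z - RtoC z * l)%C (fun z => f' z - l)%C
      (fun z => e * z) (fun _ => e)); trivial.
    - intros z Hz. apply (is_derive_on_continuous (Icc a b) (fun z => f z - RtoC z * l)%C z (f' z - l)%C);
        [exact Hz|now apply Kon].
    - intros z _. apply (continuous_mult (K := R_AbsRing)); [apply continuous_const|apply continuous_id].
    - intros z Hz. split; [|split].
      + apply (is_derive_on_interior (Icc a b)); [now apply Icc_nbhd|]. apply Kon. lra.
      + eapply is_derive_eq.
        * apply is_derive_Rmult; [apply (is_derive_const (K := R_AbsRing) (V := R_NormedModule))|
            apply (is_derive_id (K := R_AbsRing))].
        * unfold zero, one; simpl. ring.
      + apply K. lra. }
  destruct (Rle_lt_dec x y) as [le|lt].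
  - rewrite Rmin_left, Rmax_right in H by lra. specialize (key x y le H).
    rewrite Rabs_pos_eq by lra.
    replace (f y - f x - RtoC (y - x) * l)%C with ((f y - RtoC y * l) - (f x - RtoC x * l))%C
      by (rewrite RtoC_minus; ring). lra.
  - rewrite Rmin_right, Rmax_left in H by lra. specialize (key y x ltac:(lra) H).
    rewrite Rabs_left by lra.
    replace (f y - f x - RtoC (y - x) * l)%C with (- ((f x - RtoC x * l) - (f y - RtoC y * l)))%C
      by (rewrite RtoC_minus; ring). rewrite Cmod_opp. lra.
Qed.

(** * Integrals *)

Lemma ex_RIntC (h : R -> C) (a b : R) : a <= b -> continuous_on (Icc a b) h ->
  ex_RInt (V := C_R_NormedModule) h a b.
Proof.
  intros ab H.
  apply (ex_RInt_ext (V := C_R_NormedModule) (fun x => h (clamp a b x))).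
  - rewrite Rmin_left, Rmax_right by assumption. intros x Hx. rewrite clamp_id; [reflexivity|lra].
  - apply (ex_RInt_continuous (V := C_R_CompleteNormedModule)).
    intros x _. now apply (continuous_on_clamp (V := C_UniformSpace)).
Qed.

Lemma RIntC_ext (h k : R -> C) (a b : R) : a <= b ->
  (forall x, a < x < b -> h x = k x) -> RIntC h a b = RIntC k a b.
Proof.
  intros ab E. apply (RInt_ext (V := C_R_CompleteNormedModule)).
  rewrite Rmin_left, Rmax_right by assumption. exact E.
Qed.

Lemma RIntC_point (h : R -> C) (a : R) : RIntC h a a = 0%C.
Proof. apply (RInt_point (V := C_R_CompleteNormedModule)). Qed.

Lemma RIntC_clamp_cderiv (h : R -> C) (a b x : R) : a <= b -> continuous_on (Icc a b) h ->
  cderiv (fun y => RIntC (fun z => h (clamp a b z)) a y) x (h (clamp a b x)).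
Proof.
  intros ab H. apply is_derive_cderiv.
  apply (is_derive_RInt (V := C_R_NormedModule) (fun z => h (clamp a b z)) _ a x).
  - exists (mkposreal 1 Rlt_0_1). intros y _.
    apply (RInt_correct (V := C_R_CompleteNormedModule)).
    apply (ex_RInt_continuous (V := C_R_CompleteNormedModule)).
    intros z _. now apply (continuous_on_clamp (V := C_UniformSpace)).
  - now apply (continuous_on_clamp (V := C_UniformSpace)).
Qed.

(** Fundamental theorem of calculus, with differentiability required in the open
    interval only. *)
Lemma RIntC_ftc (W g : R -> C) (a b : R) : a <= b ->
  continuous_on (Icc a b) W -> continuous_on (Icc a b) g ->
  (forall x, a < x < b -> cderiv W x (g x)) -> RIntC g a b = (W b - W a)%C.
Proof.
  intros ab HW Hg Hd.
  rewrite (RIntC_ext g (fun z => g (clamp a b z)) a b ab).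
  2: { intros x Hx. rewrite clamp_id; [reflexivity|lra]. }
  set (J := fun y => RIntC (fun z => g (clamp a b z)) a y).
  assert (E : (J b - W b = J a - W a)%C).
  { apply (deriv_zero_const (fun y => J y - W y)%C a b ab).
    - apply continuous_on_Cminus; [|assumption]. apply continuous_continuous_on. intros x _.
      apply (cderiv_continuous J x (g (clamp a b x))). now apply RIntC_clamp_cderiv.
    - intros x Hx. eapply cderiv_eq.
      + apply cderiv_minus; [now apply RIntC_clamp_cderiv|now apply Hd].
      + rewrite clamp_id by lra. ring. }
  assert (J0 : J a = 0%C) by apply RIntC_point. rewrite J0 in E.
  change (J b = W b - W a)%C.
  replace (J b) with ((J b - W b) + W b)%C by ring. rewrite E. ring.
Qed.

Lemma RIntC_cderiv (g : R -> C) (a b x : R) : a < x < b -> continuous_on (Icc a b) g ->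
  cderiv (fun y => RIntC g a y) x (g x).
Proof.
  intros Hx Hg.
  apply (cderiv_ext_loc (fun y => RIntC (fun z => g (clamp a b z)) a y)).
  - destruct (Icc_nbhd a b x Hx) as [d [p K]]. exists d. split; [assumption|].
    intros y Hy. specialize (K y Hy). destruct K as [K1 K2]. apply RIntC_ext; [assumption|].
    intros z Hz. rewrite clamp_id; [reflexivity|lra].
  - eapply cderiv_eq; [apply RIntC_clamp_cderiv; [lra|assumption]|].
    rewrite clamp_id; [reflexivity|lra].
Qed.

Lemma RIntC_Cmult (c : C) (h : R -> C) (a b : R) : a <= b -> continuous_on (Icc a b) h ->
  RIntC (fun x => c * h x)%C a b = (c * RIntC h a b)%C.
Proof.
  intros ab Hh.
  assert (D : forall x, cderiv (fun y => c * RIntC (fun z => h (clamp a b z)) a y)%C x (c * h (clamp a b x))%C).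
  { intros x. eapply cderiv_eq.
    - apply cderiv_mult; [apply cderiv_const|now apply RIntC_clamp_cderiv].
    - cbv beta. ring. }
  rewrite (RIntC_ftc (fun y => c * RIntC (fun z => h (clamp a b z)) a y)%C); trivial.
  - rewrite RIntC_point. rewrite (RIntC_ext h (fun z => h (clamp a b z)) a b ab); [ring|].
    intros x Hx. rewrite clamp_id; [reflexivity|lra].
  - apply continuous_continuous_on. intros x _. exact (cderiv_continuous _ _ _ (D x)).
  - apply continuous_on_Cmult; [apply continuous_on_const|assumption].
  - intros x Hx. specialize (D x). now rewrite clamp_id in D by lra.
Qed.

Lemma RIntC_plus (h k : R -> C) (a b : R) : a <= b ->
  continuous_on (Icc a b) h -> continuous_on (Icc a b) k ->
  RIntC (fun x => h x + k x)%C a b = (RIntC h a b + RIntC k a b)%C.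
Proof.
  intros ab Hh Hk. apply (RInt_plus (V := C_R_CompleteNormedModule)); now apply ex_RIntC.
Qed.

Lemma RIntC_minus (h k : R -> C) (a b : R) : a <= b ->
  continuous_on (Icc a b) h -> continuous_on (Icc a b) k ->
  RIntC (fun x => h x - k x)%C a b = (RIntC h a b - RIntC k a b)%C.
Proof.
  intros ab Hh Hk. apply (RInt_minus (V := C_R_CompleteNormedModule)); now apply ex_RIntC.
Qed.

(** Differentiation under the integral sign, including the end points of the range of
    the parameter. *)
Lemma RIntC_param_derive (F Fr : R -> R -> C) (a b r : R) : a < b -> Icc a b r ->
  (forall y, Icc a b y -> continuous_on (Icc 0 1) (F y)) ->
  continuous_on (rect a b 0 1) (fun p => Fr (fst p) (snd p)) ->
  (forall y s, Icc a b y -> Icc 0 1 s -> is_derive_on (Icc a b) (fun y => F y s) y (Fr y s)) ->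
  is_derive_on (Icc a b) (fun y => RIntC (F y) 0 1) r (RIntC (Fr r) 0 1).
Proof.
  intros ab Hr cF cFr dF. rewrite is_derive_on_eps by assumption. intros eps He.
  assert (ab' : a <= b) by lra.
  destruct (cont2_uniform _ a b 0 1 (cont2_clamp a b 0 1 Fr ab' Rle_0_1 cFr) (eps / 2) ltac:(lra))
    as [d [p K]].
  exists d. split; [assumption|]. intros y Hy Hyr.
  assert (pt : forall s, Icc 0 1 s ->
    Cmod (F y s - F r s - RtoC (y - r) * Fr r s)%C <= eps * Rabs (y - r)).
  { intros s Hs. replace eps with (2 * (eps / 2)) by lra.
    assert (sub : forall z, Icc (Rmin r y) (Rmax r y) z -> Icc a b z /\ Rabs (z - r) < d).
    { unfold Icc, Rmin, Rmax in *. intros z. unfold Rabs in *.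
      repeat destruct Rle_dec; repeat destruct Rcase_abs; intros; lra. }
    apply (mean_value_affine (fun y => F y s) (fun y => Fr y s)); [lra|].
    intros z Hz. destruct (sub z Hz) as [Dz Bz]. split.
    - apply (is_derive_on_germ (Icc a b)); trivial; [|now apply dF].
      exists 1. split; [lra|]. intros w _ Dw. now apply sub.
    - specialize (K r s z s Hr Hs Dz Hs Bz).
      rewrite !(clamp_id a b), !(clamp_id 0 1) in K by assumption. apply K.
      rewrite Rminus_diag, Rabs_R0. assumption. }
  assert (I1 := ex_RIntC (F y) 0 1 Rle_0_1 (cF y Hy)).
  assert (I2 := ex_RIntC (F r) 0 1 Rle_0_1 (cF r Hr)).
  assert (I3 := ex_RIntC (Fr r) 0 1 Rle_0_1 (rect_slice_r a b 0 1 Fr r Hr cFr)).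
  apply (RInt_correct (V := C_R_CompleteNormedModule)) in I1, I2, I3.
  assert (I := is_RInt_minus (V := C_R_NormedModule) _ _ _ _ _ _
     (is_RInt_minus (V := C_R_NormedModule) _ _ _ _ _ _ I1 I2)
     (is_RInt_scal (V := C_R_NormedModule) _ _ _ (y - r) _ I3)).
  assert (sc : forall (k : R) (z : C), scal k (z : C_R_NormedModule) = (RtoC k * z)%C).
  { intros k z. unfold scal; simpl. unfold prod_scal, scal; simpl. unfold mult; simpl.
    unfold Cmult, RtoC; simpl. f_equal; ring. }
  apply (norm_RInt_le_const _ 0 1 _ (eps * Rabs (y - r)) Rle_0_1) in I.
  - rewrite norm_C_R, sc in I. replace ((1 - 0) * (eps * Rabs (y - r))) with (eps * Rabs (y - r)) in I by ring.
    exact I.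
  - intros s Hs. rewrite norm_C_R, sc. now apply pt.
Qed.

(** * Differentiable functions on a rectangle *)

(** Chain rule for a function of two variables along a curve. *)
Lemma is_derive_comp2 (F Fx : R -> R -> R) (h k : R -> R) (x h' k' Fy : R) :
  locally (h x, k x) (fun p : R * R => is_derive (fun z => F z (snd p)) (fst p) (Fx (fst p) (snd p))) ->
  is_derive (fun z => F (h x) z) (k x) Fy ->
  continuous (fun p : R * R => Fx (fst p) (snd p)) (h x, k x) ->
  is_derive h x h' -> is_derive k x k' ->
  is_derive (fun y => F (h y) (k y)) x (h' * Fx (h x) (k x) + k' * Fy).
Proof.
  intros H1 H2 H3 Hh Hk.
  pose proof (is_derive_filterdiff F (h x) (k x) Fx Fy H1 H2 H3) as D.
  unfold is_derive in *.
  eapply filterdiff_ext_lin.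
  - apply (filterdiff_comp'_2 (K := R_AbsRing) (T := R_NormedModule) (U := R_NormedModule)
      (V := R_NormedModule) (W := R_NormedModule) h k F x _ _
      (fun u v => plus (scal u (Fx (h x) (k x))) (scal v Fy)) Hh Hk D).
  - intros y. unfold plus, scal; simpl. unfold mult; simpl. ring.
Qed.

(** Equality of the mixed derivatives in the interior of a rectangle. *)
Lemma schwarz_real (F Fx Fy Fxy Fyx : R -> R -> R) (a b c d r t : R) :
  a < r < b -> c < t < d ->
  (forall x y, a < x < b -> c < y < d ->
     is_derive (fun z => F z y) x (Fx x y) /\ is_derive (fun z => F x z) y (Fy x y) /\
     is_derive (fun z => Fx x z) y (Fxy x y) /\ is_derive (fun z => Fy z y) x (Fyx x y)) ->
  continuous (fun p : R * R => Fxy (fst p) (snd p)) (r, t) ->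
  continuous (fun p : R * R => Fyx (fst p) (snd p)) (r, t) ->
  Fyx r t = Fxy r t.
Proof.
  intros Hr Ht H cxy cyx.
  assert (Dx : forall x y, a < x < b -> c < y < d -> Derive (fun z => F z y) x = Fx x y).
  { intros x y Hx Hy. apply is_derive_unique. now apply H. }
  assert (Dy : forall x y, a < x < b -> c < y < d -> Derive (fun z => F x z) y = Fy x y).
  { intros x y Hx Hy. apply is_derive_unique. now apply H. }
  assert (nb : forall u v x, u < x < v -> locally x (fun z => u < z < v)).
  { intros u v x Hx. apply (locally_interval _ x (Finite u) (Finite v)); simpl; intuition. }
  assert (Dyx : forall x y, a < x < b -> c < y < d ->
     is_derive (fun z => Derive (fun t => F z t) y) x (Fyx x y)).
  { intros x y Hx Hy. apply (is_derive_ext_loc (fun z => Fy z y)).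
    - generalize (nb a b x Hx). apply filter_imp. intros z Hz. now rewrite Dy.
    - now apply H. }
  assert (Dxy : forall x y, a < x < b -> c < y < d ->
     is_derive (fun z => Derive (fun t => F t z) x) y (Fxy x y)).
  { intros x y Hx Hy. apply (is_derive_ext_loc (fun z => Fx x z)).
    - generalize (nb c d y Hy). apply filter_imp. intros z Hz. now rewrite Dx.
    - now apply H. }
  transitivity (Derive (fun z => Derive (fun t => F z t) t) r).
  { symmetry. apply is_derive_unique. now apply Dyx. }
  transitivity (Derive (fun z => Derive (fun t => F t z) r) t).
  2: { apply is_derive_unique. now apply Dxy. }
  assert (L := rect_interior a b c d r t Hr Ht).
  apply Schwarz.
  - apply locally_2d_locally. generalize L. apply filter_imp. intros [x y] [Hx Hy]. simpl in *.
    destruct (H x y Hx Hy) as [H1 [H2 _]].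
    split; [|split; [|split]]; eexists; [exact H1|exact H2|now apply Dyx|now apply Dxy].
  - apply continuity_2d_pt_filterlim.
    match goal with |- filterlim _ _ (locally ?v) =>
      replace v with (Fyx r t) by (symmetry; apply is_derive_unique; now apply Dyx) end.
    apply filterlim_ext_loc with (2 := cyx). generalize L. apply filter_imp.
    intros [x y] [Hx Hy]. simpl in *. symmetry. apply is_derive_unique. now apply Dyx.
  - apply continuity_2d_pt_filterlim.
    match goal with |- filterlim _ _ (locally ?v) =>
      replace v with (Fxy r t) by (symmetry; apply is_derive_unique; now apply Dxy) end.
    apply filterlim_ext_loc with (2 := cxy). generalize L. apply filter_imp.
    intros [x y] [Hx Hy]. simpl in *. symmetry. apply is_derive_unique. now apply Dxy.
Qed.

Lemma C1_rect_cderiv_r (rho : R) (G : R -> R -> C) (r t : R) : C1_rect rho G ->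
  0 < r < rho -> 0 <= t <= 1 -> cderiv (fun s => G s t) r (dr rho G r t).
Proof.
  intros [_ [H _]] Hr Ht. apply Icc_cderiv; [assumption|]. apply (H r t); unfold Icc; lra.
Qed.

Lemma C1_rect_cderiv_t (rho : R) (G : R -> R -> C) (r t : R) : C1_rect rho G ->
  0 <= r <= rho -> 0 < t < 1 -> cderiv (fun s => G r s) t (dt G r t).
Proof.
  intros [_ [H _]] Hr Ht. apply Icc_cderiv; [assumption|]. apply (H r t); unfold Icc; lra.
Qed.

Lemma C1_rect_cont (rho : R) (G : R -> R -> C) : C1_rect rho G ->
  continuous_on (rect 0 rho 0 1) (fun p => G (fst p) (snd p)).
Proof. intros H. apply H. Qed.

Lemma C1_rect_cont_dr (rho : R) (G : R -> R -> C) : C1_rect rho G ->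
  continuous_on (rect 0 rho 0 1) (fun p => dr rho G (fst p) (snd p)).
Proof. intros H. apply H. Qed.

Lemma C1_rect_cont_dt (rho : R) (G : R -> R -> C) : C1_rect rho G ->
  continuous_on (rect 0 rho 0 1) (fun p => dt G (fst p) (snd p)).
Proof. intros H. apply H. Qed.

(** Derivative along [x |-> (c / x, 1 - x ^ 2)], a parametrization of a characteristic
    curve of [r d/dr + 2 (1 - t) d/dt]. *)
Lemma C1_rect_cderiv_char (rho : R) (G : R -> R -> C) (c x : R) : C1_rect rho G ->
  0 < x < 1 -> 0 < c / x < rho ->
  cderiv (fun x => G (c / x) (1 - x ^ 2)) x
    (RtoC (- (c / x) / x) * dr rho G (c / x)%R (1 - x ^ 2)%R
     + RtoC (- 2 * x) * dt G (c / x)%R (1 - x ^ 2)%R)%C.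
Proof.
  intros HG Hx Hc. assert (Ht : 0 < 1 - x ^ 2 < 1) by nra.
  assert (Hh : is_derive (fun x => c / x) x (- (c / x) / x)).
  { auto_derive; [lra|]. field. lra. }
  assert (Hk : is_derive (fun x => 1 - x ^ 2) x (- 2 * x)).
  { auto_derive; [trivial|]. ring. }
  assert (L : locally (c / x, 1 - x ^ 2) (fun p : R * R =>
     cderiv (fun z => G z (snd p)) (fst p) (dr rho G (fst p) (snd p)))).
  { generalize (rect_interior 0 rho 0 1 _ _ Hc Ht). apply filter_imp. intros p Hp.
    apply C1_rect_cderiv_r; trivial; lra. }
  destruct (C1_rect_cderiv_t rho G (c / x) (1 - x ^ 2) HG ltac:(lra) Ht) as [T1 T2].
  assert (K := continuous_on_rect_interior _ _ _ _ _ _ _ Hc Ht (C1_rect_cont_dr rho G HG)).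
  split.
  - eapply is_derive_eq.
    + apply (is_derive_comp2 (fun r t => fst (G r t)) (fun r t => fst (dr rho G r t)) (fun x => c / x) (fun x => 1 - x ^ 2)
        x _ _ _ ) with (2 := T1) (4 := Hh) (5 := Hk).
      * generalize L. apply filter_imp. intros p Hp. apply Hp.
      * now apply (continuous_Cfst (fun p : R * R => dr rho G (fst p) (snd p))).
    + simpl. ring.
  - eapply is_derive_eq.
    + apply (is_derive_comp2 (fun r t => snd (G r t)) (fun r t => snd (dr rho G r t)) (fun x => c / x) (fun x => 1 - x ^ 2)
        x _ _ _ ) with (2 := T2) (4 := Hh) (5 := Hk).
      * generalize L. apply filter_imp. intros p Hp. apply Hp.
      * now apply (continuous_Csnd (fun p : R * R => dr rho G (fst p) (snd p))).
    + simpl. ring.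
Qed.

Lemma C2_rect_schwarz (rho : R) (G : R -> R -> C) (r t : R) : C2_rect rho G ->
  0 < r < rho -> 0 < t < 1 -> dr rho (dt G) r t = dt (dr rho G) r t.
Proof.
  intros [H0 [Hr Ht]] Ir It.
  assert (A : forall x y, 0 < x < rho -> 0 < y < 1 ->
    cderiv (fun z => G z y) x (dr rho G x y) /\ cderiv (fun z => G x z) y (dt G x y) /\
    cderiv (fun z => dr rho G x z) y (dt (dr rho G) x y) /\
    cderiv (fun z => dt G z y) x (dr rho (dt G) x y)).
  { intros x y Hx Hy. split; [|split; [|split]].
    - apply C1_rect_cderiv_r; trivial; lra.
    - apply (C1_rect_cderiv_t rho); trivial; lra.
    - apply (C1_rect_cderiv_t rho); trivial; lra.
    - apply C1_rect_cderiv_r; trivial; lra. }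
  assert (K1 := continuous_on_rect_interior _ _ _ _ _ _ _ Ir It (C1_rect_cont_dt _ _ Hr)).
  assert (K2 := continuous_on_rect_interior _ _ _ _ _ _ _ Ir It (C1_rect_cont_dr _ _ Ht)).
  rewrite (surjective_pairing (dr rho (dt G) r t)), (surjective_pairing (dt (dr rho G) r t)).
  f_equal.
  - apply (schwarz_real (fun r t => fst (G r t)) (fun r t => fst (dr rho G r t)) (fun r t => fst (dt G r t))
      (fun r t => fst (dt (dr rho G) r t)) (fun r t => fst (dr rho (dt G) r t)) 0 rho 0 1 r t Ir It).
    + intros x y Hx Hy. destruct (A x y Hx Hy) as [A1 [A2 [A3 A4]]].
      split; [apply A1|split; [apply A2|split; [apply A3|apply A4]]].
    + exact (continuous_Cfst _ _ K1).
    + exact (continuous_Cfst _ _ K2).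
  - apply (schwarz_real (fun r t => snd (G r t)) (fun r t => snd (dr rho G r t)) (fun r t => snd (dt G r t))
      (fun r t => snd (dt (dr rho G) r t)) (fun r t => snd (dr rho (dt G) r t)) 0 rho 0 1 r t Ir It).
    + intros x y Hx Hy. destruct (A x y Hx Hy) as [A1 [A2 [A3 A4]]].
      split; [apply A1|split; [apply A2|split; [apply A3|apply A4]]].
    + exact (continuous_Csnd _ _ K1).
    + exact (continuous_Csnd _ _ K2).
Qed.

(** * Uniqueness for a first-order system *)

Lemma le_0_of_geometric (x c : R) : 0 <= c -> (forall n, x <= c * (1 / 2) ^ n) -> x <= 0.
Proof.
  intros Hc H. apply le_epsilon. intros e He. rewrite Rplus_0_l.
  destruct (pow_lt_1_zero (1 / 2)) with (y := e / (c + 1)) as [N HN].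
  - rewrite Rabs_pos_eq; lra.
  - apply Rdiv_lt_0_compat; lra.
  - specialize (HN N (Nat.le_refl N)). specialize (H N).
    assert (p : 0 <= (1 / 2) ^ N) by (apply pow_le; lra).
    rewrite Rabs_pos_eq in HN by assumption.
    apply (Rmult_lt_compat_r (c + 1)) in HN; [|lra].
    unfold Rdiv at 2 in HN. rewrite Rmult_assoc, Rinv_l in HN by lra. nra.
Qed.

(** The hypotheses say that, with [L = r d/dr + 2 (1 - t) d/dt],
    [L P = P + phi Q] along the characteristics and [dQ/dr = r phi P], with [P] vanishing
    on the side [t = 0] and [Q] on the side [r = 0]. Such a system has only the zero
    solution: integrating from these two sides gives a Volterra inequality for [P], whose
    iteration with an exponential weight is a contraction away from [t = 1], where
    [x = sqrt (1 - t)] degenerates. *)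
Lemma char_system_zero (rho M : R) (phi : R -> C) (P Q : R -> R -> C) :
  0 < rho -> 0 <= M ->
  continuous_on (rect 0 rho 0 1) (fun p => P (fst p) (snd p)) ->
  (forall r, 0 < r < rho -> Cmod (phi r) <= M) ->
  (forall r, 0 < r < rho -> P r 0 = 0%C) ->
  (forall t, 0 < t < 1 -> Q 0 t = 0%C /\ continuous_on (Icc 0 rho) (fun r => Q r t)) ->
  (forall r t, 0 < r < rho -> 0 < t < 1 ->
     cderiv (fun r => Q r t) r (RtoC r * phi r * P r t)%C) ->
  (forall c x, 0 < x < 1 -> 0 < c / x < rho ->
     cderiv (fun x => RtoC x * P (c / x)%R (1 - x ^ 2)%R)%C x
       (- (phi (c / x)%R * Q (c / x)%R (1 - x ^ 2)%R))%C) ->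
  forall t, 0 < t < 1 ->
    (forall r, 0 < r <= rho -> P r t = 0%C) /\ (forall r, 0 <= r <= rho -> Q r t = 0%C).
Proof.
  intros Hrho HM cP bphi P0 HQ dQ dP.
  assert (Hrho' : 0 <= rho) by lra.
  assert (cP2 := cont2_clamp 0 rho 0 1 P Hrho' Rle_0_1 cP).
  destruct (cont2_bounded _ 0 rho 0 1 Hrho' Rle_0_1 cP2) as [K [pK bK]].
  assert (bP : forall r t, 0 <= r <= rho -> 0 <= t <= 1 -> Cmod (P r t) <= K).
  { intros r t Hr Ht. specialize (bK r t Hr Ht). now rewrite !clamp_id in bK by assumption. }
  (* [Q] is controlled by [P] on each horizontal segment *)
  assert (bQ : forall t B, 0 < t < 1 -> 0 <= B -> (forall r, 0 < r < rho -> Cmod (P r t) <= B) ->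
     forall r, 0 <= r <= rho -> Cmod (Q r t) <= 2 * (rho ^ 2 * M * B)).
  { intros t B Ht HB PB r Hr. destruct (HQ t Ht) as [Q0 cQ].
    assert (G : Cmod (Q r t - Q 0 t)%C <= 2 * (rho * M * B * r - rho * M * B * 0)).
    { apply (mean_value_ineq (fun r => Q r t) (fun r => RtoC r * phi r * P r t)%C
        (fun x => rho * M * B * x) (fun _ => rho * M * B)); try lra.
      - intros z [Hz1 Hz2].
        assert (Dz : Icc 0 rho z) by (unfold Icc; lra).
        apply filterlim_filter_le_1 with (2 := cQ z Dz).
        intros P' HP'. unfold within in *. revert HP'. apply filter_imp.
        intros w Hw [Dw1 Dw2]. apply Hw. unfold Icc. lra.
      - intros z _. apply (continuous_mult (K := R_AbsRing)); [apply continuous_const|apply continuous_id].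
      - intros z Hz. split; [apply dQ; lra|split].
        + eapply is_derive_eq.
          * apply is_derive_Rmult; [apply (is_derive_const (K := R_AbsRing) (V := R_NormedModule))|
              apply (is_derive_id (K := R_AbsRing))].
          * unfold zero, one; simpl. ring.
        + rewrite !Cmod_mult, Cmod_R, Rabs_pos_eq by lra.
          apply Rmult_le_compat; [| |apply Rmult_le_compat|]; trivial; try apply Cmod_ge_0;
            try apply Rmult_le_pos; try apply Cmod_ge_0; try lra; [apply bphi|apply PB]; lra. }
    rewrite Q0 in G. replace (Q r t - 0)%C with (Q r t) in G by ring.
    eapply Rle_trans; [exact G|].
    assert (0 <= rho * M * B) by (repeat apply Rmult_le_pos; lra). nra. }
  (* For [x >= e] the weighted bound on [P] halves at each step. The constant [8] of the rate
     collects the factors [2] of the bound on [Q] and of the mean value inequality for [P],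
     and the factor [2] gained. *)
  assert (main : forall e, 0 < e < 1 -> forall n x r, e <= x < 1 -> 0 < r <= rho ->
    x * Cmod (P r (1 - x ^ 2)) <=
      K * exp ((8 * (rho ^ 2 * M ^ 2 / e) + 1) * (1 - x)) * (1 / 2) ^ n).
  { intros e He. set (k := 8 * (rho ^ 2 * M ^ 2 / e) + 1).
    assert (Hk0 : 0 <= rho ^ 2 * M ^ 2 / e).
    { apply Rmult_le_pos; [apply Rmult_le_pos; apply pow2_ge_0|]. left. apply Rinv_0_lt_compat. lra. }
    assert (Hk : 1 <= k) by (unfold k; lra).
    induction n as [|n IH]; intros x r Hx Hr.
    - rewrite pow_O. assert (1 <= exp (k * (1 - x))).
      { rewrite <- exp_0 at 1. assert (0 < k * (1 - x)) by nra. left; now apply exp_increasing. }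
      assert (B := bP r (1 - x ^ 2) ltac:(lra) ltac:(nra)). pose proof (Cmod_ge_0 (P r (1 - x ^ 2))).
      rewrite Rmult_1_r. apply Rle_trans with K; [nra|]. rewrite <- (Rmult_1_r K) at 1.
      apply Rmult_le_compat_l; lra.
    - set (b := fun z => K * exp (k * (1 - z)) * (1 / 2) ^ n).
      assert (bpos : forall z, 0 <= b z).
      { intros z. unfold b. apply Rmult_le_pos; [apply Rmult_le_pos|apply pow_le; lra]; [lra|].
        left; apply exp_pos. }
      set (Cc := 2 * (rho ^ 2 * M ^ 2 / e)).
      assert (hb : forall z s, x < z < 1 -> 0 < s < rho ->
         Cmod (- (phi s * Q s (1 - z ^ 2)%R))%C <= Cc * b z).
      { intros z s Hz Hs. rewrite Cmod_opp, Cmod_mult.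
        assert (Q1 : Cmod (Q s (1 - z ^ 2)) <= 2 * (rho ^ 2 * M * (b z / e))).
        { apply bQ; [nra| | |lra].
          - apply Rmult_le_pos; [apply bpos|]. left. apply Rinv_0_lt_compat. lra.
          - intros s' Hs'. specialize (IH z s' ltac:(lra) ltac:(lra)). fold (b z) in IH.
            apply Rmult_le_reg_r with e; [lra|].
            unfold Rdiv. rewrite Rmult_assoc, Rinv_l, Rmult_1_r by lra.
            pose proof (Cmod_ge_0 (P s' (1 - z ^ 2))). nra. }
        eapply Rle_trans.
        { apply Rmult_le_compat; [apply Cmod_ge_0|apply Cmod_ge_0|apply (bphi s Hs)|exact Q1]. }
        right. unfold Cc. field. lra. }
      assert (MV : Cmod (RtoC 1 * P (x * r / 1)%R (1 - 1 ^ 2)%R - RtoC x * P (x * r / x)%R (1 - x ^ 2)%R)%C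
         <= 2 * (- (Cc / k) * b 1 - - (Cc / k) * b x)).
      { apply (mean_value_ineq (fun z => RtoC z * P (x * r / z)%R (1 - z ^ 2)%R)%C
          (fun z => - (phi (x * r / z)%R * Q (x * r / z)%R (1 - z ^ 2)%R))%C
          (fun z => - (Cc / k) * b z) (fun z => Cc * b z)); [lra| | |].
        - apply (continuous_on_Cext _ (fun z => RtoC z *
             P (clamp 0 rho (x * r / z)) (clamp 0 1 (1 - z ^ 2)))%C).
          { intros z [Hz1 Hz2].
            assert (0 < x * r / z <= rho).
            { split; [apply Rdiv_lt_0_compat; nra|]. apply Rle_div_l; nra. }
            rewrite !clamp_id; [reflexivity|nra|lra]. }
          apply continuous_continuous_on. intros z [Hz1 Hz2].
          apply continuous_Cmult; [apply continuous_RtoC, continuous_id|].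
          apply (cont2_comp (fun r t => P (clamp 0 rho r) (clamp 0 1 t)) (fun z => x * r / z) (fun z => 1 - z ^ 2)); [exact cP2| |].
          + apply (ex_derive_continuous (K := R_AbsRing) (V := R_NormedModule)). auto_derive. lra.
          + apply (ex_derive_continuous (K := R_AbsRing) (V := R_NormedModule)). auto_derive. trivial.
        - intros z _. apply (ex_derive_continuous (K := R_AbsRing) (V := R_NormedModule)).
          unfold b. auto_derive. trivial.
        - intros z Hz.
          assert (0 < x * r / z < rho).
          { split; [apply Rdiv_lt_0_compat; nra|]. apply Rlt_div_l; nra. }
          split; [apply dP; lra|split; [|now apply hb]].
          unfold b. auto_derive; [trivial|]. change (1 + - z) with (1 - z).
          generalize (exp (k * (1 - z))) as E, ((1 / 2) ^ n) as h. intros E h. field. lra. }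
      replace (1 - 1 ^ 2) with 0 in MV by ring. rewrite (P0 (x * r / 1)) in MV.
      2: { unfold Rdiv. rewrite Rinv_1. nra. }
      replace (x * r / x) with r in MV by (field; lra).
      replace (RtoC 1 * 0 - RtoC x * P r (1 - x ^ 2)%R)%C with (- (RtoC x * P r (1 - x ^ 2)%R))%C in MV by ring.
      rewrite Cmod_opp, Cmod_mult, Cmod_R, Rabs_pos_eq in MV by lra.
      eapply Rle_trans; [exact MV|].
      assert (Hck : 0 <= Cc / k <= 1 / 4).
      { unfold Cc. split.
        - apply Rmult_le_pos; [lra|]. left. apply Rinv_0_lt_compat. lra.
        - apply Rle_div_l; [lra|]. unfold k. lra. }
      replace (K * exp (k * (1 - x)) * (1 / 2) ^ S n) with (b x / 2) by (unfold b; simpl; field).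
      pose proof (bpos 1). pose proof (bpos x). nra. }
  assert (PZ : forall r t, 0 < r <= rho -> 0 < t < 1 -> P r t = 0%C).
  { intros r t Hr Ht.
    assert (s0 : 0 < sqrt (1 - t)) by (apply sqrt_lt_R0; lra).
    assert (s2 : sqrt (1 - t) ^ 2 = 1 - t) by (apply pow2_sqrt; lra).
    assert (s1 : sqrt (1 - t) < 1) by nra.
    set (x := sqrt (1 - t)) in *.
    assert (Z : x * Cmod (P r (1 - x ^ 2)) <= 0).
    { eapply le_0_of_geometric; [|intros n; apply (main x); lra].
      apply Rmult_le_pos; [lra|]. left; apply exp_pos. }
    replace (1 - x ^ 2) with t in Z by lra.
    apply Cmod_eq_0. pose proof (Cmod_ge_0 (P r t)). nra. }
  intros t Ht. split; [intros r Hr; now apply PZ|].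
  intros r Hr. apply Cmod_eq_0. pose proof (Cmod_ge_0 (Q r t)).
  assert (Cmod (Q r t) <= 2 * (rho ^ 2 * M * 0)); [|lra].
  apply bQ; trivial; [lra|]. intros s Hs. rewrite PZ by lra. rewrite Cmod_0. lra.
Qed.

(** * First-order relation between the two kernels *)

(** What is needed of [phi = f' / f]: it is continuous, with derivative [phi'] in the open
    interval, the potentials are continuous, and by the last two conditions [qA] and [qB]
    are the potentials of [1 / f] and [f]. Exchanging [qA] and [qB] amounts to changing
    the sign of [phi]. *)
Definition darboux_pair (rho : R) (phi phi' qA qB : R -> C) : Prop :=
  continuous_on (Icc 0 rho) phi /\
  (forall r, 0 < r < rho -> cderiv phi r (phi' r)) /\
  continuous_on (Icc 0 rho) qA /\ continuous_on (Icc 0 rho) qB /\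
  (forall r, 0 < r < rho ->
     (RtoC r * qA r = RtoC r * (phi r * phi r) - RtoC r * phi' r - phi r)%C) /\
  (forall r, 0 < r < rho ->
     (RtoC r * qB r = RtoC r * (phi r * phi r) + RtoC r * phi' r + phi r)%C).

(** The side condition of a kernel at [t = 0], in differentiated form. *)
Lemma kernel_at_0 (rho : R) (q : R -> C) (G : R -> R -> C) :
  continuous_on (Icc 0 rho) q -> is_kernel rho q G ->
  forall r, 0 < r < rho ->
    cderiv (fun r => G r 0) r (RtoC r * q r)%C /\ dr rho G r 0 = (RtoC r * q r)%C.
Proof.
  intros Hq [[H1 _] [_ [H0 _]]] r Hr.
  assert (D : cderiv (fun r => G r 0) r (RtoC r * q r)%C).
  { apply (cderiv_ext_loc (fun r => RIntC (fun tau => RtoC tau * q tau)%C 0 r)).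
    - destruct (Icc_nbhd 0 rho r Hr) as [d [p K]]. exists d. split; [assumption|].
      intros y Hy. symmetry. apply H0. now apply K.
    - apply (RIntC_cderiv (fun tau => RtoC tau * q tau)%C 0 rho r Hr).
      apply continuous_on_Cmult; [|assumption].
      apply continuous_continuous_on. intros x _. apply continuous_RtoC, continuous_id. }
  split; [exact D|].
  apply (cderiv_unique (fun s => G s 0) r); [|exact D].
  apply C1_rect_cderiv_r; trivial; lra.
Qed.

(** Both sides vanish at [r = 0] and have the same derivative. *)
Lemma kernel_diff_at_0 (rho : R) (phi phi' qA qB : R -> C) (A B : R -> R -> C) :
  0 < rho -> darboux_pair rho phi phi' qA qB ->
  is_kernel rho qA A -> is_kernel rho qB B ->
  forall r, 0 <= r <= rho -> (A r 0 - B r 0 = - (2 * RtoC r * phi r))%C.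
Proof.
  intros Hrho [cphi [dphi [cqA [cqB [HqA HqB]]]]] KA KB r Hr.
  assert (I0 : Icc 0 1 0) by (unfold Icc; lra).
  assert (cA := rect_slice_t 0 rho 0 1 A 0 I0 (C1_rect_cont _ _ (proj1 (proj1 KA)))).
  assert (cB := rect_slice_t 0 rho 0 1 B 0 I0 (C1_rect_cont _ _ (proj1 (proj1 KB)))).
  assert (E : (A r 0 - B r 0 + 2 * (RtoC r * phi r) = A 0 0 - B 0 0 + 2 * (RtoC 0 * phi 0))%C).
  { apply (deriv_zero_const (fun r => A r 0%R - B r 0%R + 2 * (RtoC r * phi r))%C 0 r); [lra| |].
    - apply (continuous_on_subset (Icc 0 rho)); [unfold Icc; intros; lra|].
      apply continuous_on_Cplus; [apply continuous_on_Cminus|].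
      + exact cA.
      + exact cB.
      + apply continuous_on_Cmult; [apply continuous_on_const|].
        apply continuous_on_Cmult; [apply continuous_on_id_RtoC|assumption].
    - intros x Hx. assert (Hx' : 0 < x < rho) by lra.
      destruct (kernel_at_0 rho qA A cqA KA x Hx') as [DA _].
      destruct (kernel_at_0 rho qB B cqB KB x Hx') as [DB _].
      eapply cderiv_eq.
      + apply cderiv_plus; [apply (cderiv_minus _ _ _ _ _ DA DB)|].
        apply cderiv_mult; [apply cderiv_const|]. apply cderiv_mult; [apply cderiv_id|apply (dphi x Hx')].
      + cbv beta. rewrite (HqA x Hx'), (HqB x Hx'). ring. }
  destruct KA as [_ [_ [_ A0]]], KB as [_ [_ [_ B0]]].
  rewrite (A0 0), (B0 0) in E by (unfold Icc; lra).
  replace (A r 0 - B r 0)%C with ((A r 0 - B r 0 + 2 * (RtoC r * phi r)) - 2 * (RtoC r * phi r))%C by ring.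
  rewrite E. ring.
Qed.

(** First-order relation between the kernel [A] of [1 / f] and the kernel [B] of [f];
    it is half the sum of [r P = 0] and [Q = 0] for the [P] and [Q] of the proof. *)
Lemma kernel_relation (rho : R) (phi phi' qA qB : R -> C) (A B : R -> R -> C) :
  0 < rho -> darboux_pair rho phi phi' qA qB ->
  is_kernel rho qA A -> is_kernel rho qB B ->
  forall r t, 0 <= r <= rho -> 0 < t < 1 ->
    (RtoC r * (dr rho A r t + phi r * A r t)
       = (A r t - B r t) - RtoC (1 - t) * (dt A r t - dt B r t))%C.
Proof.
  intros Hrho DP KA KB.
  assert (bd := kernel_diff_at_0 rho phi phi' qA qB A B Hrho DP KA KB).
  destruct DP as [cphi [dphi [cqA [cqB [HqA HqB]]]]].
  assert (zA := kernel_at_0 rho qA A cqA KA). assert (zB := kernel_at_0 rho qB B cqB KB).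
  destruct KA as [C2A [EA [_ A0]]], KB as [C2B [EB [_ B0]]].
  assert (swA := fun r t => C2_rect_schwarz rho A r t C2A).
  assert (swB := fun r t => C2_rect_schwarz rho B r t C2B).
  destruct C2A as [CA [CAr CAt]], C2B as [CB [CBr CBt]].
  set (P := fun r t => (dr rho A r t + dr rho B r t + phi r * (A r t - B r t))%C).
  set (Q := fun r t => (RtoC r * (dr rho A r t - dr rho B r t) + RtoC r * phi r * (A r t + B r t)
     - 2 * (A r t - B r t) + 2 * RtoC (1 - t)%R * (dt A r t - dt B r t))%C).
  destruct (bounded_continuity (K := R_AbsRing) (V := C_R_NormedModule) (fun r => phi (clamp 0 rho r)) 0 rho) as [M bM].
  { intros x _. apply (continuous_on_clamp (V := C_UniformSpace)); [lra|assumption]. }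
  assert (bphi : forall r, 0 <= r <= rho -> Cmod (phi r) < M).
  { intros r Hr. specialize (bM r Hr). rewrite clamp_id in bM by assumption. now rewrite norm_C_R in bM. }
  assert (Z : forall t, 0 < t < 1 -> (forall r, 0 < r <= rho -> P r t = 0%C) /\ (forall r, 0 <= r <= rho -> Q r t = 0%C)).
  { apply (char_system_zero rho M phi P Q Hrho).
    - left. eapply Rle_lt_trans; [apply Cmod_ge_0|apply (bphi 0); lra].
    - unfold P. apply continuous_on_Cplus; [apply continuous_on_Cplus|apply continuous_on_Cmult;
        [|apply continuous_on_Cminus]].
      + now apply C1_rect_cont.
      + now apply C1_rect_cont.
      + now apply continuous_on_fst.
      + now apply C1_rect_cont.
      + now apply C1_rect_cont.
    - intros r Hr. left. apply bphi. lra.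
    - intros r Hr. unfold P. destruct (zA r Hr) as [_ ->], (zB r Hr) as [_ ->].
      rewrite (bd r) by lra. rewrite (HqA r Hr), (HqB r Hr). ring.
    - intros t Ht. split.
      + assert (TA : dt A 0 t = 0%C).
        { apply (cderiv_unique (fun s => A 0 s) t); [apply (C1_rect_cderiv_t rho); trivial; lra|].
          apply (cderiv_ext_loc (fun _ => RtoC 0)); [|apply cderiv_const].
          destruct (Icc_nbhd 0 1 t Ht) as [d [p K]]. exists d. split; [assumption|].
          intros y Hy. symmetry. apply A0. now apply K. }
        assert (TB : dt B 0 t = 0%C).
        { apply (cderiv_unique (fun s => B 0 s) t); [apply (C1_rect_cderiv_t rho); trivial; lra|].
          apply (cderiv_ext_loc (fun _ => RtoC 0)); [|apply cderiv_const].
          destruct (Icc_nbhd 0 1 t Ht) as [d [p K]]. exists d. split; [assumption|].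
          intros y Hy. symmetry. apply B0. now apply K. }
        unfold Q. rewrite TA, TB, (A0 t), (B0 t) by (unfold Icc; lra). ring.
      + assert (It : Icc 0 1 t) by (unfold Icc; lra). unfold Q.
        assert (sl : forall G, continuous_on (rect 0 rho 0 1) (fun p => G (fst p) (snd p)) ->
          continuous_on (Icc 0 rho) (fun r => G r t)) by (intros G; now apply rect_slice_t).
        apply C1_rect_cont in CA as c1. apply C1_rect_cont in CB as c2.
        apply C1_rect_cont in CAr as c3. apply C1_rect_cont in CBr as c4.
        apply C1_rect_cont in CAt as c5. apply C1_rect_cont in CBt as c6.
        apply sl in c1, c2, c3, c4, c5, c6.
        assert (cid := continuous_on_id_RtoC (Icc 0 rho)).
        apply continuous_on_Cplus; [apply continuous_on_Cminus; [apply continuous_on_Cplus|]|].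
        * exact (continuous_on_Cmult _ _ _ cid (continuous_on_Cminus _ _ _ c3 c4)).
        * exact (continuous_on_Cmult _ _ _ (continuous_on_Cmult _ _ _ cid cphi) (continuous_on_Cplus _ _ _ c1 c2)).
        * apply continuous_on_Cmult; [apply continuous_on_const|exact (continuous_on_Cminus _ _ _ c1 c2)].
        * apply continuous_on_Cmult; [apply continuous_on_const|exact (continuous_on_Cminus _ _ _ c5 c6)].
    - intros r t Hr Ht. assert (Ht' : 0 <= t <= 1) by lra.
      assert (a1 := C1_rect_cderiv_r rho A r t CA Hr Ht'). assert (b1 := C1_rect_cderiv_r rho B r t CB Hr Ht').
      assert (a2 := C1_rect_cderiv_r rho _ r t CAr Hr Ht'). assert (b2 := C1_rect_cderiv_r rho _ r t CBr Hr Ht').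
      assert (a3 := C1_rect_cderiv_r rho _ r t CAt Hr Ht'). assert (b3 := C1_rect_cderiv_r rho _ r t CBt Hr Ht').
      rewrite swA in a3 by assumption. rewrite swB in b3 by assumption.
      specialize (EA r t ltac:(unfold Icc; lra) Ht'). specialize (EB r t ltac:(unfold Icc; lra) Ht').
      specialize (HqA r Hr). specialize (HqB r Hr). rewrite RtoC_mult in EA, EB.
      unfold Q. eapply cderiv_eq.
      + apply cderiv_plus; [apply cderiv_minus; [apply cderiv_plus|]|].
        * apply cderiv_mult; [apply cderiv_id|apply (cderiv_minus _ _ _ _ _ a2 b2)].
        * apply cderiv_mult; [apply cderiv_mult; [apply cderiv_id|apply (dphi r Hr)]|apply (cderiv_plus _ _ _ _ _ a1 b1)].
        * apply cderiv_mult; [apply cderiv_const|apply (cderiv_minus _ _ _ _ _ a1 b1)].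
        * apply cderiv_mult; [apply cderiv_const|apply (cderiv_minus _ _ _ _ _ a3 b3)].
      + unfold P. cbv beta.
        (* difference of the two kernel equations, the potentials expressed by [phi] *)
        match type of EA with ?ea = _ => match type of EB with ?eb = _ =>
        transitivity (ea - eb + (RtoC r * qA r) * A r t - (RtoC r * qB r) * B r t
           + (phi r + RtoC r * phi' r) * (A r t + B r t)
           + RtoC r * phi r * (dr rho A r t + dr rho B r t))%C end end.
        * ring.
        * rewrite EA, EB, HqA, HqB. ring.
    - intros c x Hx Hc. assert (Ht : 0 < 1 - x ^ 2 < 1) by nra.
      assert (a1 := C1_rect_cderiv_char rho A c x CA Hx Hc). assert (b1 := C1_rect_cderiv_char rho B c x CB Hx Hc).
      assert (a2 := C1_rect_cderiv_char rho _ c x CAr Hx Hc). assert (b2 := C1_rect_cderiv_char rho _ c x CBr Hx Hc).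
      specialize (EA (c / x) (1 - x ^ 2) ltac:(unfold Icc; lra) ltac:(unfold Icc; lra)).
      specialize (EB (c / x) (1 - x ^ 2) ltac:(unfold Icc; lra) ltac:(unfold Icc; lra)).
      specialize (HqA _ Hc). specialize (HqB _ Hc).
      assert (ph : cderiv (fun x => phi (c / x)) x (RtoC (- (c / x) / x) * phi' (c / x)%R)%C).
      { apply (cderiv_comp phi (fun x => c / x)); [now apply dphi|]. auto_derive; [lra|]. field. lra. }
      unfold P. eapply cderiv_eq.
      + apply cderiv_mult; [apply cderiv_id|].
        apply cderiv_plus; [apply (cderiv_plus _ _ _ _ _ a2 b2)|].
        apply (cderiv_mult _ _ _ _ _ ph (cderiv_minus _ _ _ _ _ a1 b1)).
      + unfold Q. cbv beta.
        replace (2 * (1 - (1 - x ^ 2))) with (2 * x * x) in EA by ring.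
        replace (2 * (1 - (1 - x ^ 2))) with (2 * x * x) in EB by ring.
        replace (1 - (1 - x ^ 2)) with (x * x) by ring.
        assert (e1 : RtoC (- (c / x) / x) = (- RtoC (c / x) / RtoC x)%C).
        { rewrite RtoC_div by lra. now rewrite RtoC_opp. }
        assert (nx : RtoC x <> 0%C) by (intros h; apply RtoC_inj in h; lra).
        rewrite e1. rewrite !RtoC_mult in EA, EB |- *. revert EA EB HqA HqB nx.
        replace (RtoC (-2)) with (- (2))%C by (rewrite <- RtoC_opp; f_equal; lra).
        generalize (RtoC (c / x)) as w, (RtoC x) as X. intros w X EA EB HqA HqB nx.
        (* sum of the two kernel equations, the potentials expressed by [phi] *)
        match type of EA with ?ea = _ => match type of EB with ?eb = _ =>
        match goal with |- ?l = ?r =>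
        transitivity (r + (- (ea + eb)) - (w * qA (c / x)%R) * A (c / x)%R (1 - x ^ 2)%R
           - (w * qB (c / x)%R) * B (c / x)%R (1 - x ^ 2)%R
           + w * (phi (c / x)%R * phi (c / x)%R) * (A (c / x)%R (1 - x ^ 2)%R + B (c / x)%R (1 - x ^ 2)%R)
           - (w * phi' (c / x)%R + phi (c / x)%R) * (A (c / x)%R (1 - x ^ 2)%R - B (c / x)%R (1 - x ^ 2)%R))%C end end end.
        * field. exact nx.
        * rewrite EA, EB, HqA, HqB. ring. }
  intros r t Hr Ht. destruct (Z t Ht) as [ZP ZQ].
  assert (E1 : (RtoC r * P r t = 0)%C).
  { destruct (Req_dec r 0) as [->|nr]; [ring|]. rewrite ZP by lra. ring. }
  assert (E2 := ZQ r Hr). unfold P in E1. unfold Q in E2.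
  assert (two : RtoC 2 <> 0%C) by (intros h; apply RtoC_inj in h; lra).
  match type of E1 with ?a = _ => match type of E2 with ?b = _ => match goal with |- ?l = ?r =>
    transitivity (r + (a + b) / 2)%C; [field; exact two|rewrite E1, E2; field; exact two] end end end.
Qed.

(** * From the kernels to the operators *)

(** Continuity of the integrand of [Top], and of its derivative in [r], as a function of
    [(r, s)]. *)
Lemma rect_cont_integrand (b rho : R) (G : R -> R -> C) (v : R -> C) : 0 < b <= rho ->
  continuous_on (rect 0 rho 0 1) (fun p => G (fst p) (snd p)) -> continuous_on (Icc 0 b) v ->
  continuous_on (rect 0 b 0 1)
    (fun p => G (fst p) (1 - snd p ^ 2)%R * v (snd p ^ 2 * fst p)%R)%C.
Proof.
  intros Hb HG Hv.
  apply (continuous_on_Cext _ (fun p => G (clamp 0 rho (fst p)) (clamp 0 1 (1 - snd p ^ 2)) *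
     v (clamp 0 b (snd p ^ 2 * fst p)))%C).
  { intros [y s] [[Hy1 Hy2] [Hs1 Hs2]]. simpl fst in *. simpl snd in *.
    assert (0 <= s ^ 2 <= 1) by nra. rewrite !clamp_id; [reflexivity|nra|lra|lra]. }
  apply continuous_continuous_on. intros p _.
  assert (sq : continuous (fun p : R * R => snd p ^ 2) p).
  { apply (continuous_comp (U := prod_UniformSpace R_UniformSpace R_UniformSpace) snd (fun s => s ^ 2)).
    - destruct p; apply continuous_snd.
    - apply (ex_derive_continuous (K := R_AbsRing) (V := R_NormedModule)). auto_derive. trivial. }
  assert (fs : continuous (fun p : R * R => fst p) p) by (destruct p; apply continuous_fst).
  apply continuous_Cmult.
  - assert (cG := cont2_clamp 0 rho 0 1 G ltac:(lra) Rle_0_1 HG).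
    apply (cont2_comp (fun r t => G (clamp 0 rho r) (clamp 0 1 t)) (fun p : R * R => fst p) (fun p : R * R => 1 - snd p ^ 2)); trivial.
    apply (continuous_minus (V := R_NormedModule)); [apply continuous_const|exact sq].
  - apply (continuous_comp (fun p : R * R => snd p ^ 2 * fst p) (fun x => v (clamp 0 b x))).
    + now apply (continuous_mult (K := R_AbsRing)).
    + apply (continuous_on_clamp (V := C_UniformSpace)); [lra|assumption].
Qed.

(** Both intertwining relations at once: [phi] is the logarithmic derivative of [g], and
    [A], [B] are the kernels belonging to [1 / g] and [g]. *)
Lemma transmutation_relation (rho : R) (g phi : R -> C) (A B : R -> R -> C) (u : R -> C) :
  0 < rho ->
  (forall r, Icc 0 rho r -> g r <> 0%C /\ is_derive_on (Icc 0 rho) g r (phi r * g r)%C) ->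
  C1_rect rho A -> C1_rect rho B ->
  (forall r t, 0 <= r <= rho -> 0 < t < 1 ->
    (RtoC r * (dr rho A r t + phi r * A r t)
       = (A r t - B r t) - RtoC (1 - t) * (dt A r t - dt B r t))%C) ->
  (forall r, 0 <= r <= rho -> (A r 0 - B r 0 = - (2 * RtoC r * phi r))%C) ->
  Ck_on 1 (Ico 0 rho) u ->
  forall r, 0 <= r < rho ->
    Dop_defined rho g (Top A u) r /\
    Dop rho g (Top A u) r = Top B (Dop rho (fun _ => RtoC 1) u) r.
Proof.
  intros Hrho Hg CA CB rel bd [du' cdu] r Hr.
  set (du := derive_on (Ico 0 rho) u) in *.
  assert (Du : forall y, Ico 0 rho y -> is_derive_on (Ico 0 rho) u y (du y)).
  { intros y Hy. apply derive_on_correct; [assumption|now apply accum_Ico|now apply du']. }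
  assert (cu : continuous_on (Ico 0 rho) u).
  { intros y Hy. apply (is_derive_on_continuous (Ico 0 rho) u y (du y)); auto. }
  (* [u] need not extend to [rho]; the parameter is kept in the compact interval [[0,b]] *)
  set (b := (r + rho) / 2). assert (Hb : r < b < rho) by (unfold b; lra).
  assert (sub : forall x, Icc 0 b x -> Ico 0 rho x) by (unfold Icc, Ico; intros; lra).
  assert (cu' := continuous_on_subset _ _ _ sub cu). assert (cdu' := continuous_on_subset _ _ _ sub cdu).
  assert (cA := C1_rect_cont _ _ CA). assert (cAr := C1_rect_cont_dr _ _ CA). assert (cB := C1_rect_cont _ _ CB).
  set (F := fun y s => (RtoC s * A y (1 - s ^ 2)%R * u (s ^ 2 * y)%R)%C).
  set (Fr := fun y s => (RtoC s * (dr rho A y (1 - s ^ 2)%R * u (s ^ 2 * y)%R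
     + RtoC (s ^ 2) * (A y (1 - s ^ 2)%R * du (s ^ 2 * y)%R)))%C).
  set (K := fun s => (RtoC s * B r (1 - s ^ 2)%R * (RtoC (s ^ 2 * r) * du (s ^ 2 * r)%R))%C).
  assert (sndc : forall f : R -> R, (forall x, continuous f x) ->
     continuous_on (rect 0 b 0 1) (fun p => RtoC (f (snd p)))).
  { intros f Hf. apply continuous_continuous_on. intros p _. apply continuous_RtoC.
    apply (continuous_comp snd f); [destruct p; apply continuous_snd|apply Hf]. }
  assert (c1 : forall x, continuous (fun x : R => x) x) by (intros; apply continuous_id).
  assert (c2 : forall x, continuous (fun x : R => x ^ 2) x).
  { intros x. apply (ex_derive_continuous (K := R_AbsRing) (V := R_NormedModule)). auto_derive. trivial. }
  assert (cF : continuous_on (rect 0 b 0 1) (fun p => F (fst p) (snd p))).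
  { unfold F. apply (continuous_on_Cext _ (fun p => RtoC (snd p) *
       (A (fst p) (1 - snd p ^ 2)%R * u (snd p ^ 2 * fst p)%R))%C); [intros; ring|].
    apply continuous_on_Cmult; [now apply (sndc (fun x => x))|].
    apply (rect_cont_integrand b rho); trivial; lra. }
  assert (cFr : continuous_on (rect 0 b 0 1) (fun p => Fr (fst p) (snd p))).
  { unfold Fr. apply continuous_on_Cmult; [now apply (sndc (fun x => x))|].
    apply continuous_on_Cplus; [apply (rect_cont_integrand b rho); trivial; lra|].
    apply continuous_on_Cmult; [now apply (sndc (fun x => x ^ 2))|].
    apply (rect_cont_integrand b rho); trivial; lra. }
  assert (cK : continuous_on (Icc 0 1) K).
  { unfold K. apply (rect_slice_r 0 b 0 1 (fun y s => RtoC s * B y (1 - s ^ 2)%R * (RtoC (s ^ 2 * y) * du (s ^ 2 * y)%R))%C r).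
    { unfold Icc; lra. }
    apply (continuous_on_Cext _ (fun p => RtoC (snd p) *
       (RtoC (snd p ^ 2) * (RtoC (fst p) * (B (fst p) (1 - snd p ^ 2)%R * du (snd p ^ 2 * fst p)%R))))%C).
    { intros p _. rewrite RtoC_mult. ring. }
    apply continuous_on_Cmult; [now apply (sndc (fun x => x))|].
    apply continuous_on_Cmult; [now apply (sndc (fun x => x ^ 2))|].
    apply continuous_on_Cmult; [apply (continuous_on_fst 0 b 0 1 (fun x => RtoC x)), continuous_on_id_RtoC|].
    apply (rect_cont_integrand b rho); trivial; lra. }
  assert (Ir : Icc 0 b r) by (unfold Icc; lra). assert (Ir' : Ico 0 rho r) by (unfold Ico; lra).
  assert (Ir'' : Icc 0 rho r) by (unfold Icc; lra).
  assert (sub2 : forall x, Icc 0 b x -> Icc 0 rho x) by (unfold Icc; intros; lra).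
  assert (dF : forall y s, Icc 0 b y -> Icc 0 1 s -> is_derive_on (Icc 0 b) (fun y => F y s) y (Fr y s)).
  { intros y s Hy Hs. assert (Hs2 : 0 <= s ^ 2 <= 1) by (unfold Icc in Hs; nra).
    assert (S : forall z, Icc 0 b z -> Ico 0 rho (s ^ 2 * z)) by (unfold Icc, Ico; intros; nra).
    unfold F, Fr. eapply is_derive_on_eq.
    - apply is_derive_on_mult; [assumption|apply is_derive_on_mult; [assumption|now apply is_derive_on_const|]|].
      + apply (is_derive_on_germ (Icc 0 rho)); trivial; [now apply sub2| |].
        * exists 1. split; [lra|]. intros z _. apply sub2.
        * apply derive_on_correct; [now apply sub2|apply accum_Icc; [lra|now apply sub2]|].
          apply CA; [now apply sub2|unfold Icc; lra].
      + apply (is_derive_on_comp_scale (Ico 0 rho)); trivial; [now apply S|]. apply Du. now apply S.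
    - cbv beta. unfold dr. ring. }
  assert (D1 : is_derive_on (Icc 0 b) (fun y => RIntC (F y) 0 1) r (RIntC (Fr r) 0 1)).
  { apply RIntC_param_derive; trivial; [lra|].
    intros y Hy. now apply (rect_slice_r 0 b 0 1 F y). }
  assert (germ : forall f l, is_derive_on (Icc 0 b) f r l -> is_derive_on (Ico 0 rho) f r l).
  { intros f l. apply is_derive_on_germ; trivial. exists (b - r). split; [lra|].
    intros y Hy Dy. apply Rabs_def2 in Hy. unfold Icc, Ico in *. lra. }
  assert (D2 : is_derive_on (Ico 0 rho) (Top A u) r (du r + RIntC (Fr r) 0 1)%C).
  { apply (is_derive_on_plus (Ico 0 rho) u (fun y => RIntC (F y) 0 1)); trivial; [now apply Du|now apply germ]. }
  destruct (Hg r Ir'') as [g0 Dg].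
  assert (D3 : is_derive_on (Ico 0 rho) (fun s => g s * Top A u s)%C r
     (phi r * g r * Top A u r + g r * (du r + RIntC (Fr r) 0 1))%C).
  { apply is_derive_on_mult; trivial. apply germ.
    apply (is_derive_on_germ (Icc 0 rho)); trivial. exists 1. split; [lra|]. intros y _. apply sub2. }
  split; [eexists; exact D3|].
  unfold Dop at 1. rewrite (derive_on_eq (Ico 0 rho) _ r _ Ir' (accum_Ico _ _ _ Ir') D3).
  assert (D1u : forall y, Ico 0 rho y -> Dop rho (fun _ => RtoC 1) u y = (RtoC y * du y)%C).
  { intros y Hy. unfold Dop.
    rewrite (derive_on_eq (Ico 0 rho) (fun s => RtoC 1 * u s)%C y (du y) Hy (accum_Ico _ _ _ Hy)).
    - field.
    - apply (is_derive_on_ext _ u); [assumption|intros; ring|now apply Du]. }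
  unfold Top at 2. rewrite (D1u r Ir').
  rewrite (RIntC_ext (fun s => RtoC s * B r (1 - s ^ 2)%R * Dop rho (fun _ => RtoC 1) u (s ^ 2 * r)%R)%C
    K 0 1 Rle_0_1).
  2: { intros s Hs. unfold K. rewrite D1u; [reflexivity|].
       assert (0 < s ^ 2 < 1) by nra. unfold Ico. nra. }
  change (Top A u r) with (u r + RIntC (F r) 0 1)%C.
  assert (cFr1 := rect_slice_r 0 b 0 1 F r Ir cF). assert (cFr2 := rect_slice_r 0 b 0 1 Fr r Ir cFr).
  assert (key : (RtoC r * phi r * RIntC (F r) 0 1 + RtoC r * RIntC (Fr r) 0 1 - RIntC K 0 1
     = - (RtoC r * phi r) * u r)%C).
  { assert (m1 := continuous_on_Cmult _ _ _ (continuous_on_const (Icc 0 1) (RtoC r * phi r)%C) cFr1).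
    assert (m2 := continuous_on_Cmult _ _ _ (continuous_on_const (Icc 0 1) (RtoC r)) cFr2).
    assert (m12 := continuous_on_Cplus _ _ _ m1 m2).
    transitivity (RIntC (fun s => RtoC r * phi r * F r s + RtoC r * Fr r s - K s)%C 0 1).
    { rewrite (RIntC_minus (fun s => RtoC r * phi r * F r s + RtoC r * Fr r s)%C K 0 1 Rle_0_1 m12 cK).
      rewrite (RIntC_plus (fun s => RtoC r * phi r * F r s)%C (fun s => RtoC r * Fr r s)%C 0 1 Rle_0_1 m1 m2).
      rewrite (RIntC_Cmult (RtoC r * phi r)%C (F r) 0 1 Rle_0_1 cFr1).
      now rewrite (RIntC_Cmult (RtoC r) (Fr r) 0 1 Rle_0_1 cFr2). }
    (* the antiderivative of the integrand, by the relation [rel] at [t = 1 - s ^ 2] *)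
    set (W := fun s => (RtoC (s ^ 2) / 2 * ((A r (1 - s ^ 2)%R - B r (1 - s ^ 2)%R) * u (s ^ 2 * r)%R))%C).
    rewrite (RIntC_ftc W); [| lra | | |].
    - unfold W. replace (1 - 1 ^ 2) with 0 by ring. replace (1 ^ 2 * r) with r by ring.
      rewrite (bd r) by lra. replace (1 ^ 2) with 1 by ring. replace (0 ^ 2) with 0 by ring. field.
    - unfold W.
      apply (rect_slice_r 0 b 0 1 (fun y s => (RtoC (s ^ 2) / 2 * ((A y (1 - s ^ 2)%R - B y (1 - s ^ 2)%R) * u (s ^ 2 * y)%R))%C) r Ir).
      apply continuous_on_Cmult.
      + apply continuous_on_Cmult; [now apply (sndc (fun x => x ^ 2))|apply continuous_on_const].
      + apply (rect_cont_integrand b rho (fun y t => A y t - B y t)%C); trivial; [lra|].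
        now apply continuous_on_Cminus.
    - exact (continuous_on_Cminus _ _ _ m12 cK).
    - intros s Hs. assert (Ht : 0 < 1 - s ^ 2 < 1) by nra.
      assert (hk : is_derive (fun s => 1 - s ^ 2) s (- 2 * s)) by (auto_derive; [trivial|ring]).
      assert (hs : is_derive (fun s => s ^ 2) s (2 * s)) by (auto_derive; [trivial|ring]).
      assert (hr : is_derive (fun s => s ^ 2 * r) s (2 * s * r)) by (auto_derive; [trivial|ring]).
      assert (dA := cderiv_comp (A r) (fun s => 1 - s ^ 2) s _ _ (C1_rect_cderiv_t rho A r _ CA Ir'' Ht) hk).
      assert (dB := cderiv_comp (B r) (fun s => 1 - s ^ 2) s _ _ (C1_rect_cderiv_t rho B r _ CB Ir'' Ht) hk).
      assert (In : forall z, 0 < z < 1 -> Ico 0 rho (z ^ 2 * r)) by (intros z Hz; assert (0 < z ^ 2 < 1) by nra; unfold Ico; nra).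
      destruct (is_derive_on_extend _ _ _ _ (In s Hs) (Du _ (In s Hs))) as [u1 [U1 Eu]].
      assert (dU : cderiv (fun s => u (s ^ 2 * r)) s (RtoC (2 * s * r) * du (s ^ 2 * r)%R)%C).
      { apply (cderiv_ext_loc (fun s => u1 (s ^ 2 * r))).
        - exists (Rmin s (1 - s)). pose proof (Rmin_l s (1 - s)). pose proof (Rmin_r s (1 - s)).
          split; [apply Rmin_pos; lra|]. intros y Hy. apply Rabs_def2 in Hy. apply Eu, In. lra.
        - now apply (cderiv_comp u1 (fun s => s ^ 2 * r)). }
      unfold W. eapply cderiv_eq.
      + apply cderiv_mult; [apply cderiv_mult; [apply (cderiv_RtoC _ _ _ hs)|apply cderiv_const]|].
        apply cderiv_mult; [apply (cderiv_minus _ _ _ _ _ dA dB)|exact dU].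
      + cbv beta. unfold F, Fr, K.
        specialize (rel r (1 - s ^ 2) Ir'' Ht). replace (1 - (1 - s ^ 2)) with (s ^ 2) in rel by ring.
        rewrite !RtoC_mult.
        match type of rel with ?l = ?m =>
        transitivity (RtoC s * m * u (s ^ 2 * r)%R + RtoC s * RtoC (s ^ 2) * RtoC r *
          ((A r (1 - s ^ 2)%R - B r (1 - s ^ 2)%R) * du (s ^ 2 * r)%R))%C end.
        * replace (RtoC (-2)) with (- (2))%C by (rewrite <- RtoC_opp; f_equal; lra).
          field.
        * rewrite <- rel. ring. }
  match type of key with ?l = ?m =>
    transitivity (l + RtoC r * phi r * u r + RtoC r * du r + RIntC K 0 1)%C; [field; exact g0|rewrite key; ring] end.
Qed.

Theorem proposition32 :
  forall (Om : C -> Prop) (rho : R) (q f : R -> C) (Gf Grf : R -> R -> C),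
    0 < rho ->
    star_domain Om rho ->
    Ck_on 1 (Icc 0 rho) q ->
    radial_solution Om rho q f ->
    is_kernel rho q Gf ->
    is_kernel rho (q_recip rho q f) Grf ->
    forall u : R -> C,
      Ck_on 1 (Ico 0 rho) u ->
      forall r : R, 0 <= r < rho ->
        (Dop_defined rho f (Top Grf u) r /\
         Dop rho f (Top Grf u) r = Top Gf (Dop rho (fun _ => RtoC 1) u) r) /\
        (Dop_defined rho (recip f) (Top Gf u) r /\
         Dop rho (recip f) (Top Gf u) r = Top Grf (Dop rho (fun _ => RtoC 1) u) r).
Proof.
  intros Om rho q f Gf Grf Hrho _ Hq [[ef Cf'] [nz [ode _]]] KB KA u Hu r Hr.
  set (f' := derive_on (Icc 0 rho) f) in *. set (f'' := derive_on (Icc 0 rho) f') in *.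
  set (phi := fun r => (f' r / f r)%C).
  set (phi' := fun r => (f'' r / f r - phi r * phi r)%C).
  assert (cq := Ck_on_1_continuous_on _ _ Hq). assert (cf' := Ck_on_1_continuous_on _ _ Cf').
  assert (Df : forall x, Icc 0 rho x -> is_derive_on (Icc 0 rho) f x (f' x)).
  { intros x Hx. apply derive_on_correct; [assumption|now apply accum_Icc|now apply ef]. }
  assert (cf : continuous_on (Icc 0 rho) f).
  { intros x Hx. apply (is_derive_on_continuous _ f x (f' x)); auto. }
  assert (cphi : continuous_on (Icc 0 rho) phi).
  { apply continuous_on_Cmult; [assumption|now apply continuous_on_Cinv]. }
  assert (dphi : forall x, 0 < x < rho -> cderiv phi x (phi' x)).
  { intros x Hx. assert (Ix : Icc 0 rho x) by (unfold Icc; lra). specialize (nz x Ix).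
    eapply cderiv_eq.
    - apply cderiv_mult; [apply Icc_cderiv; [exact Hx|now apply Cf']|].
      apply cderiv_inv; [assumption|]. apply Icc_cderiv; [exact Hx|now apply ef].
    - cbv beta. fold f' f''. unfold phi', phi. field. assumption. }
  assert (HqB : forall x, 0 < x < rho ->
     (RtoC x * q x = RtoC x * (phi x * phi x) + RtoC x * phi' x + phi x)%C).
  { intros x Hx. specialize (ode x Hx). assert (Ix : Icc 0 rho x) by (unfold Icc; lra). specialize (nz x Ix).
    assert (nx : RtoC x <> 0%C) by (intros h; apply RtoC_inj in h; lra).
    rewrite RtoC_div in ode by lra. unfold phi', phi.
    match type of ode with ?o = _ => match goal with |- ?a = ?b =>
      transitivity (b - RtoC x * o / f x)%C; [field; now split|rewrite ode; field; assumption] end end. }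
  assert (HqA : forall x, 0 < x < rho ->
     (RtoC x * q_recip rho q f x = RtoC x * (phi x * phi x) - RtoC x * phi' x - phi x)%C).
  { intros x Hx. unfold q_recip. fold f'. change (f' x / f x)%C with (phi x).
    transitivity (2 * RtoC x * (phi x * phi x) - RtoC x * q x)%C; [ring|]. rewrite HqB by assumption. ring. }
  assert (cqA : continuous_on (Icc 0 rho) (q_recip rho q f)).
  { unfold q_recip. fold f'. apply continuous_on_Cminus; [|assumption].
    apply continuous_on_Cmult; [apply continuous_on_const|now apply (continuous_on_Cmult _ phi phi)]. }
  assert (DP : darboux_pair rho phi phi' (q_recip rho q f) q) by (repeat (split; [assumption|]); assumption).
  assert (DP' : darboux_pair rho (fun x => - phi x)%C (fun x => - phi' x)%C q (q_recip rho q f)).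
  { split; [|split; [|split; [assumption|split; [assumption|split]]]].
    - apply (continuous_on_Cext _ (fun x => 0 - phi x)%C); [intros; ring|].
      apply continuous_on_Cminus; [apply continuous_on_const|assumption].
    - intros x Hx. now apply cderiv_opp, dphi.
    - intros x Hx. rewrite HqB by assumption. ring.
    - intros x Hx. rewrite HqA by assumption. ring. }
  split.
  - apply (transmutation_relation rho f phi Grf Gf); trivial.
    + intros x Hx. split; [now apply nz|]. eapply is_derive_on_eq; [now apply Df|].
      unfold phi. field. now apply nz.
    + exact (proj1 (proj1 KA)).
    + exact (proj1 (proj1 KB)).
    + now apply (kernel_relation rho phi phi' (q_recip rho q f) q).
    + now apply (kernel_diff_at_0 rho phi phi' (q_recip rho q f) q).
  - apply (transmutation_relation rho (recip f) (fun x => - phi x)%C Gf Grf); trivial.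
    + intros x Hx. specialize (nz x Hx). split.
      * unfold recip. intros h. assert (E : (f x * / f x = 1)%C) by (field; assumption).
        rewrite h in E. rewrite Cmult_0_r in E. apply RtoC_inj in E. lra.
      * eapply is_derive_on_eq; [apply is_derive_on_recip; [assumption|assumption|now apply Df]|].
        unfold phi, recip. field. assumption.
    + exact (proj1 (proj1 KB)).
    + exact (proj1 (proj1 KA)).
    + now apply (kernel_relation rho (fun x => - phi x)%C (fun x => - phi' x)%C q (q_recip rho q f)).
    + now apply (kernel_diff_at_0 rho (fun x => - phi x)%C (fun x => - phi' x)%C q (q_recip rho q f)).
Qed.
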